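(* There exist structured single-touch computation DAGs (for arbitrarily large $P$ and span $T_\infty$, with $\log P = O(T_\infty)$) and executions of them by parsimonious work stealing on $P$ processors, choosing the future thread first at every fork (with suitable timing of processor steps and steals), that incur $\Omega(PT_\infty^2)$ deviations and $\Omega(PT_\infty^2)$ additional cache misses, while the sequential execution of the same computation incurs $O(PT_\infty^2/C)$ cache misses. Here each processor has a private fully associative LRU cache of $C$ lines.
   Context: Computation model. A future-parallel computation is a finite DAG whose nodes are tasks. Every node has in-degree and out-degree in $\{1,2\}$, except a distinguished root node (in-degree $0$) and a distinguished final node (out-degree $0$). Edges are continuation edges, future edges and touch edges. A thread is a maximal chain of nodes connected by continuation edges. The main thread begins at the root and ends at the final node. Every other thread $t$ begins at a node with an incoming future edge from a node $v$ of another thread $t'$; then $v$ is the fork of $t$, $t'$ is the parent thread, and $t$ is the future thread at $v$. A fork $v$ has two children: the first node of $t$ (the left child) and the continuation successor of $v$ in $t'$ (the right child); both have in-degree $1$ and are not touches. The last node of every non-main thread has exactly one outgoing edge, a touch edge into another thread. If there is a touch edge from node $v_1$ of thread $t_1$ to node $v_2$ of thread $t_2\neq t_1$, and a continuation edge from $u_2$ to $v_2$, then $v_2$ is a touch of $t_1$, $v_1$ its future parent, $u_2$ its local parent. A node $w$ is a descendant of $u$ if there is a directed path from $u$ to $w$. The span $T_\infty$ is the length of a longest directed path. A DAG is a structured future-parallel computation if for the future thread $t$ of any fork $v$: (1) the local parents of the touches of $t$ are descendants of $v$, and (2) at least one touch of $t$ is a descendant of the right child of $v$. It is a structured single-touch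 computation if, in addition, each future thread $t$ spawned at a fork $v$ has exactly one touch, and this touch is a descendant of the right child of $v$. Scheduler. In parsimonious work stealing with $P$ processors, each processor has a deque. A node is ready when all its parents have been executed. After executing a node of out-degree 1, a processor continues with its child if ready. After a fork it pushes one child onto the bottom of its deque and executes the other (''future thread first'': execute the left child, push the right child). A processor with nothing to execute pops the bottom of its own deque if nonempty, and otherwise steals the top node of another processor's deque. The sequential execution is the execution with $P=1$. Deviation. A node $v_2$ is a deviation if, letting $v_1$ be the node executed immediately before $v_2$ in the sequential execution, the processor executing $v_2$ did not execute $v_1$ immediately before $v_2$. Caches. Each node accesses at most one memory block; each processor has a private fully associative LRU cache of $C$ lines. Additional cache misses = misses of the parallel execution minus misses of the sequential execution. *)

(* Defs.v *)
From Stdlib Require Import List Arith Relations.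
Import ListNotations.

Inductive ekind := Cont | Fut | Touch.

(* Nodes are the naturals 0 .. nnodes-1.  Each node accesses at most one
   memory block (blk v = None: no access). *)
Record comp := mkComp {
  nnodes : nat;
  edges  : list (nat * nat * ekind);
  root   : nat;
  final  : nat;
  blk    : nat -> option nat }.

Definition edge (G : comp) u v k := In (u, v, k) (edges G).
Definition step (G : comp) u v := exists k, edge G u v k.
Definition reach (G : comp) := clos_refl_trans nat (step G).
Definition outdeg (G : comp) u :=
  length (filter (fun e => match e with (x, _, _) => Nat.eqb x u end) (edges G)).
Definition indeg (G : comp) v :=
  length (filter (fun e => match e with (_, y, _) => Nat.eqb y v end) (edges G)).

Definition cedge (G : comp) u v := edge G u v Cont.
Definition creach (G : comp) := clos_refl_trans nat (cedge G).
Definition same_thread (G : comp) u v := creach G u v \/ creach G v u.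
Definition thread_head (G : comp) h := h < nnodes G /\ forall u, ~ cedge G u h.
Definition thread_last (G : comp) u := u < nnodes G /\ forall w, ~ cedge G u w.
Definition in_main (G : comp) v := creach G (root G) v.

Definition is_touch_of (G : comp) h v2 :=
  exists v1, creach G h v1 /\ edge G v1 v2 Touch.

Definition is_fp_comp (G : comp) : Prop :=
  (forall u v k, edge G u v k -> u < nnodes G /\ v < nnodes G) /\
  root G < nnodes G /\ final G < nnodes G /\ root G <> final G /\
  NoDup (map fst (edges G)) /\
  (forall v, ~ clos_trans nat (step G) v v) /\
  indeg G (root G) = 0 /\ outdeg G (final G) = 0 /\
  (forall v, v < nnodes G -> v <> root G -> 1 <= indeg G v <= 2) /\
  (forall v, v < nnodes G -> v <> final G -> 1 <= outdeg G v <= 2) /\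
  (forall u v w, cedge G u v -> cedge G u w -> v = w) /\
  (forall u v w, cedge G u w -> cedge G v w -> u = v) /\
  in_main G (final G) /\
  (forall h, thread_head G h -> h <> root G -> exists v, edge G v h Fut) /\
  (forall v l, edge G v l Fut ->
     (forall u, ~ cedge G u l) /\ ~ same_thread G v l /\
     exists r, cedge G v r /\ indeg G l = 1 /\ indeg G r = 1 /\
       (forall x, ~ edge G x l Touch) /\ (forall x, ~ edge G x r Touch)) /\
  (forall u, thread_last G u -> ~ in_main G u ->
     outdeg G u = 1 /\ exists w, edge G u w Touch) /\
  (forall v1 v2, edge G v1 v2 Touch ->
     thread_last G v1 /\ ~ in_main G v1 /\ ~ same_thread G v1 v2 /\
     exists u2, cedge G u2 v2).

(* structured future-parallel computation; the future thread spawned at fork v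
   is the one whose first node h satisfies edge G v h Fut *)
Definition structured (G : comp) : Prop :=
  is_fp_comp G /\
  forall v h, edge G v h Fut ->
    (forall v2 u2, is_touch_of G h v2 -> cedge G u2 v2 -> reach G v u2) /\
    (exists r v2, cedge G v r /\ is_touch_of G h v2 /\ reach G r v2).

Definition structured_single_touch (G : comp) : Prop :=
  structured G /\
  forall v h, edge G v h Fut ->
    exists v2, is_touch_of G h v2 /\ (forall w, is_touch_of G h w -> w = v2) /\
      (forall r, cedge G v r -> reach G r v2).

Fixpoint is_path (G : comp) (l : list nat) : Prop :=
  match l with
  | [] => False
  | [_] => True
  | u :: ((v :: _) as l') => step G u v /\ is_path G l'
  end.

Definition has_span (G : comp) (s : nat) : Prop :=
  (exists l, is_path G l /\ length l = S s) /\
  (forall l, is_path G l -> length l <= S s).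

(* per processor: node assigned to execute next (if any) and deque
   (head of the list = bottom, last element = top); plus executed nodes *)
Record wsstate := mkS {
  cur  : nat -> option nat;
  dq   : nat -> list nat;
  done : list nat }.

Definition upd {A : Type} (f : nat -> A) (p : nat) (x : A) : nat -> A :=
  fun q => if Nat.eqb q p then x else f q.

Definition ready (G : comp) (d : list nat) v := forall u, step G u v -> In u d.

(* One atomic action of one processor; label Some (p, v) = processor p
   executes node v.  Arbitrary interleavings model arbitrary timing. *)
Inductive ws_step (G : comp) (P : nat) : wsstate -> option (nat * nat) -> wsstate -> Prop :=
| st_fork : forall s p v l r,
    p < P -> cur s p = Some v -> ~ In v (done s) -> ready G (done s) v ->
    edge G v l Fut -> cedge G v r ->
    ws_step G P s (Some (p, v))
      (mkS (upd (cur s) p (Some l)) (upd (dq s) p (r :: dq s p)) (v :: done s))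
| st_one_ready : forall s p v c,
    p < P -> cur s p = Some v -> ~ In v (done s) -> ready G (done s) v ->
    outdeg G v = 1 -> step G v c -> ready G (v :: done s) c ->
    ws_step G P s (Some (p, v)) (mkS (upd (cur s) p (Some c)) (dq s) (v :: done s))
| st_one_wait : forall s p v c,
    p < P -> cur s p = Some v -> ~ In v (done s) -> ready G (done s) v ->
    outdeg G v = 1 -> step G v c -> ~ ready G (v :: done s) c ->
    ws_step G P s (Some (p, v)) (mkS (upd (cur s) p None) (dq s) (v :: done s))
| st_last : forall s p v,
    p < P -> cur s p = Some v -> ~ In v (done s) -> ready G (done s) v ->
    outdeg G v = 0 ->
    ws_step G P s (Some (p, v)) (mkS (upd (cur s) p None) (dq s) (v :: done s))
| st_pop : forall s p x rest,
    p < P -> cur s p = None -> dq s p = x :: rest ->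
    ws_step G P s None (mkS (upd (cur s) p (Some x)) (upd (dq s) p rest) (done s))
| st_steal : forall s p q xs x,
    p < P -> q < P -> p <> q -> cur s p = None -> dq s p = [] ->
    dq s q = xs ++ [x] ->
    ws_step G P s None (mkS (upd (cur s) p (Some x)) (upd (dq s) q xs) (done s)).

Inductive ws_run (G : comp) (P : nat) : wsstate -> list (nat * nat) -> wsstate -> Prop :=
| run_nil : forall s, ws_run G P s [] s
| run_exec : forall s p v s1 tr s2,
    ws_step G P s (Some (p, v)) s1 -> ws_run G P s1 tr s2 ->
    ws_run G P s ((p, v) :: tr) s2
| run_sched : forall s s1 tr s2,
    ws_step G P s None s1 -> ws_run G P s1 tr s2 -> ws_run G P s tr s2.

Definition ws_init (G : comp) : wsstate :=
  mkS (fun p => if Nat.eqb p 0 then Some (root G) else None) (fun _ => []) [].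

Definition ws_execution (G : comp) (P : nat) (E : list (nat * nat)) : Prop :=
  exists s, ws_run G P (ws_init G) E s /\ forall v, v < nnodes G -> In v (done s).

Definition sequential_execution (G : comp) (S : list nat) : Prop :=
  exists E, ws_execution G 1 E /\ S = map snd E.

Fixpoint prev_table (E : list (nat * nat)) (last : nat -> option nat)
  : list (nat * option nat) :=
  match E with
  | [] => []
  | (p, v) :: E' => (v, last p) :: prev_table E' (upd last p (Some v))
  end.

Fixpoint lookup (L : list (nat * option nat)) (v : nat) : option (option nat) :=
  match L with
  | [] => None
  | (w, o) :: L' => if Nat.eqb w v then Some o else lookup L' v
  end.

Definition is_deviation (E : list (nat * nat)) (v1 v2 : nat) : bool :=
  match lookup (prev_table E (fun _ => None)) v2 with
  | Some (Some u) => negb (Nat.eqb u v1)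
  | _ => true
  end.

Definition deviations (S : list nat) (E : list (nat * nat)) : nat :=
  length (filter (fun pr => is_deviation E (fst pr) (snd pr)) (combine S (tl S))).

(* fully associative LRU cache of C lines; most recent first;
   returns (miss?, new cache) *)
Definition lru_access (C : nat) (c : list nat) (b : nat) : bool * list nat :=
  if existsb (Nat.eqb b) c then (false, b :: remove Nat.eq_dec b c)
  else (true, firstn C (b :: c)).

Fixpoint misses_aux (G : comp) (C : nat) (E : list (nat * nat))
  (caches : nat -> list nat) : nat :=
  match E with
  | [] => 0
  | (p, v) :: E' =>
      match blk G v with
      | None => misses_aux G C E' caches
      | Some b =>
          let (m, c') := lru_access C (caches p) b in
          (if m then 1 else 0) + misses_aux G C E' (upd caches p c')
      end
  end.

Definition misses (G : comp) (C : nat) (E : list (nat * nat)) : nat :=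
  misses_aux G C E (fun _ => []).

(* Main.v *)
(** One grid with [m] rows and [k] columns already yields about [m * k] deviations with two
    processors.  A spine of [m] nested forks leaves [m] rows in the deque of its owner; a thief
    steals them from the top, that is, in the reverse of the sequential order.  Row [j] forks
    threads [X j 0; T j 0], ..., [X j (k-1); T j (k-1)], where [T j i] touches the thread of
    [T j (i-1)] and [T j 0] touches the thread that contains row [j+1].  Sequentially every
    [X j i] is followed by [T j i].  The thief reaches row [j] before row [j+1], so it is blocked
    after each [X j i] and runs all the [X j i] first; the whole chain of [T j i] runs later in one
    cascade.  The last touches are collected by a chain of [Y] nodes, so that the span stays
    linear in [m + k].

    The accesses made by the [X] and the [T] of a row are, alternately, descending and ascending
    sweeps over [C + 1] blocks: with LRU a sweep that reverses the previous one misses once, whereas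
    a sweep that repeats it misses always.  Sequentially the directions alternate; in the parallel
    execution the [X] of a row make only descending sweeps and the [T] only ascending ones.

    About [P / 4] grids are the leaves of a fork-join tree of logarithmic depth.  Its two subtrees
    are executed one after the other, while an idle processor holds the root of the right one.
    That keeps the deque of the processor entering a grid empty, and needs only [log P] processors
    besides the two that work on the grid. *)

Require Import Defs.
From Stdlib Require Import List Arith Lia Relations Permutation FunctionalExtensionality.
From Stdlib Require Import Classical.
Import ListNotations.

(** Nodes are numbered by their position in the sequential execution, and edges are stored as
    distances. The sequential trace is then [seq 0 N], acyclicity is immediate, and a grid or a
    subtree can be moved to any offset unchanged. As the claim concerns every sequential execution,
    determinism for one processor is proved as well.

    The parameter [T] serves as the number of rows, and rows have about [2 * T] columns, so one grid
    gives order [T * T] deviations with span linear in [T]. The row length is a multiple of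
    [2 * (C + 1)]: rows then consist of whole sweeps, and the sequential alternation of directions
    passes unbroken from row to row and from grid to grid, at about two misses for [2 * (C + 1)]
    columns.

    In the parallel run the cache content at the start of a row depends on earlier work. Each run of
    [gX] or of [gT] nodes therefore gives up its first sweep, a loss of at most [C + 1] accesses,
    which is small against [T]. For the scheduler, the difficulty is to know at each touch whether
    its other parent has been executed; inside a grid this is tracked by a few counters, one or two
    for each kind of node. *)

(** * DAGs numbered in sequential execution order *)

(* Node [u] with [Fork r] has left child [u + 1] and right child [u + r]; [Next] is a continuation
   edge to [u + 1], and [Touching d] a touch edge to [u + d].  The incoming edges of a node are
   described in the same way by distances backwards; a [Join d] has local parent [v - 1] and future
   parent [v - d]. *)
Inductive onode := Fork (r : nat) | Next | Touching (d : nat) | Stop.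
Inductive inode := Root | Spawned | RightOf (r : nat) | Join (d : nat).

Record layout := mkLayout {
  out : nat -> onode;
  inn : nat -> inode;
  mem : nat -> option nat }.

Definition elist u o : list (nat * nat * ekind) :=
  match o with
  | Fork r => [(u, u + 1, Fut); (u, u + r, Cont)]
  | Next => [(u, u + 1, Cont)]
  | Touching d => [(u, u + d, Touch)]
  | Stop => []
  end.

Definition comp_of (n : nat) (L : layout) : comp :=
  mkComp n (flat_map (fun u => elist u (out L u)) (seq 0 n)) 0 (n - 1) (mem L).

(** The bounds [lo] and [hi] confine edges to a block. They can be relaxed, so the tables of a
    subtree are checked once and reused inside the larger tree. *)
Definition out_ok (L : layout) lo hi u :=
  match out L u with
  | Fork r => 2 <= r /\ u + r <= hi /\ inn L (u + 1) = Spawned /\ inn L (u + r) = RightOf r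
  | Next => u + 1 <= hi /\ exists d, inn L (u + 1) = Join d
  | Touching d => 2 <= d /\ u + d <= hi /\ inn L (u + d) = Join d
  | Stop => False
  end /\ lo <= u.

Definition in_ok (L : layout) lo v :=
  match inn L v with
  | Root => False
  | Spawned => exists r, out L (v - 1) = Fork r
  | RightOf r => lo + r <= v /\ out L (v - r) = Fork r
  | Join d => lo + d <= v /\ out L (v - 1) = Next /\ out L (v - d) = Touching d
  end.

Record wf (n : nat) (L : layout) : Prop := {
  wf_size : 2 <= n;
  wf_out : forall u, u < n - 1 -> out_ok L 0 (n - 1) u;
  wf_stop : out L (n - 1) = Stop;
  wf_in : forall v, 0 < v < n -> in_ok L 0 v;
  wf_root : inn L 0 = Root }.

Lemma NoDup_map_fst_flat_map (L : layout) l :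
  (forall u r, In u l -> out L u = Fork r -> 2 <= r) -> NoDup l ->
  NoDup (map fst (flat_map (fun u => elist u (out L u)) l)).
Proof.
  intros H; induction l as [|u l IH]; intros ND; simpl; [constructor|].
  inversion ND; subst. rewrite map_app. apply NoDup_app.
  - specialize (H u). destruct (out L u) as [r| |d|]; simpl;
      repeat constructor; simpl; try tauto.
    intros [E|[]]. injection E as E. specialize (H r (or_introl eq_refl) eq_refl). lia.
  - apply IH; auto. intros; eapply H; eauto. right; auto.
  - intros [x y] M1 M2. apply in_map_iff in M1 as [[[a b] k] [E M1]].
    simpl in E; injection E as -> ->.
    apply in_map_iff in M2 as [[[a' b'] k'] [E H4]]. simpl in E; injection E as -> ->.
    apply in_flat_map in H4 as [w [Hw H4]].
    assert (x = u) by (destruct (out L u); simpl in M1; intuition congruence).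
    assert (x = w) by (destruct (out L w); simpl in H4; intuition congruence).
    congruence.
Qed.

Lemma length_filter_eq {A} (f : A -> bool) (l l' : list A) :
  NoDup l -> NoDup l' -> (forall e, In e l' <-> In e l /\ f e = true) ->
  length (filter f l) = length l'.
Proof.
  intros H1 H2 H. apply Permutation_length, NoDup_Permutation; auto.
  - now apply NoDup_filter.
  - intros x. rewrite filter_In, H. tauto.
Qed.

Section Layout.
Variables (n : nat) (L : layout) (W : wf n L).
Let G := comp_of n L.

Lemma edge_out u v k : edge G u v k <-> u < n /\ In (u, v, k) (elist u (out L u)).
Proof.
  unfold edge, G; simpl. rewrite in_flat_map. split.
  - intros [w [Hw H]]. apply in_seq in Hw.
    assert (u = w) by (destruct (out L w); simpl in H; intuition congruence).
    subst; split; [lia|auto].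
  - intros [H1 H2]. exists u. split; auto. apply in_seq; lia.
Qed.

Lemma out_cases u : u < n ->
  match out L u with
  | Fork r => 2 <= r /\ u + r < n /\ inn L (u + 1) = Spawned /\ inn L (u + r) = RightOf r
  | Next => u + 1 < n /\ exists d, inn L (u + 1) = Join d
  | Touching d => 2 <= d /\ u + d < n /\ inn L (u + d) = Join d
  | Stop => u = n - 1
  end.
Proof.
  intros H. destruct (Nat.eq_dec u (n - 1)) as [->|N].
  - now rewrite (wf_stop _ _ W).
  - pose proof (wf_size _ _ W). destruct (wf_out _ _ W u ltac:(lia)) as [O _].
    destruct (out L u); intuition lia.
Qed.

Lemma in_cases v : v < n ->
  match inn L v with
  | Root => v = 0
  | Spawned => 1 <= v /\ exists r, out L (v - 1) = Fork r
  | RightOf r => 2 <= r <= v /\ out L (v - r) = Fork r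
  | Join d => 2 <= d <= v /\ out L (v - 1) = Next /\ out L (v - d) = Touching d
  end.
Proof.
  intros H. destruct (Nat.eq_dec v 0) as [->|N].
  - now rewrite (wf_root _ _ W).
  - pose proof (wf_in _ _ W v ltac:(lia)) as I. unfold in_ok in I.
    destruct (inn L v); try tauto.
    + split; [lia|auto].
    + destruct I as [I1 I2]. pose proof (out_cases (v - r) ltac:(lia)) as O.
      rewrite I2 in O. intuition lia.
    + destruct I as [I1 [I2 I3]]. pose proof (out_cases (v - d) ltac:(lia)) as O.
      rewrite I3 in O. intuition lia.
Qed.

Definition ilist v i : list (nat * nat * ekind) :=
  match i with
  | Root => []
  | Spawned => [(v - 1, v, Fut)]
  | RightOf r => [(v - r, v, Cont)]
  | Join d => [(v - 1, v, Cont); (v - d, v, Touch)]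
  end.

(** [out] and [inn] describe the same edges from their two ends, and [wf] makes them agree.
    Questions about children become a case on [out], questions about parents, such as readiness, a
    case on [inn]. *)
Lemma edge_in u v k : edge G u v k <-> v < n /\ In (u, v, k) (ilist v (inn L v)).
Proof.
  rewrite edge_out. split; intros [H1 H2].
  - pose proof (out_cases u H1) as O.
    destruct (out L u) eqn:EO; simpl in H2.
    + destruct H2 as [H2|[H2|[]]]; injection H2 as <- <-.
      * split; [lia|]. destruct O as (_ & _ & -> & _). simpl. left. f_equal. f_equal. lia.
      * split; [lia|]. destruct O as (_ & _ & _ & ->). simpl. left. f_equal. f_equal. lia.
    + destruct H2 as [H2|[]]; injection H2 as <- <-. split; [lia|].
      destruct O as (_ & d & ->). simpl. left. f_equal. f_equal. lia.
    + destruct H2 as [H2|[]]; injection H2 as <- <-. split; [lia|].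
      destruct O as (_ & _ & ->). simpl. right. left. f_equal. f_equal. lia.
    + destruct H2.
  - pose proof (in_cases v H1) as I.
    destruct (inn L v) eqn:EI; simpl in H2.
    + destruct H2.
    + destruct H2 as [H2|[]]; injection H2 as <- <-. split; [lia|].
      destruct I as (I1 & r & ->). simpl. left. f_equal. f_equal. lia.
    + destruct H2 as [H2|[]]; injection H2 as <- <-. split; [lia|].
      destruct I as (I1 & ->). simpl. right. left. f_equal. f_equal. lia.
    + destruct H2 as [H2|[H2|[]]]; injection H2 as <- <-; (split; [lia|]).
      * destruct I as (I1 & -> & _). simpl. left. f_equal. f_equal. lia.
      * destruct I as (I1 & _ & ->). simpl. left. f_equal. f_equal. lia.
Qed.

Lemma edges_NoDup : NoDup (map fst (edges G)).
Proof.
  apply NoDup_map_fst_flat_map; [|apply seq_NoDup].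
  intros u r Hu E. apply in_seq in Hu. pose proof (out_cases u ltac:(lia)) as O.
  rewrite E in O. lia.
Qed.

Lemma edge_lt u v k : edge G u v k -> u < v < n.
Proof.
  intros H. pose proof H as H'. apply edge_in in H as [Hv _]. apply edge_out in H' as [Hu H].
  pose proof (out_cases u Hu) as O.
  destruct (out L u); simpl in H; repeat (destruct H as [H|H]; [injection H as <- <-; lia|]);
  destruct H.
Qed.

Lemma step_lt u v : step G u v -> u < v < n.
Proof. intros [k H]; eapply edge_lt; eauto. Qed.

Lemma outdeg_eq u : u < n -> outdeg G u = length (elist u (out L u)).
Proof.
  intros Hu. unfold outdeg. apply length_filter_eq.
  - eapply NoDup_map_inv, edges_NoDup.
  - pose proof (out_cases u Hu) as O.
    destruct (out L u); simpl; repeat constructor; simpl; try tauto. intros [E|[]]. congruence.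
  - intros [[x y] k]. change (In (x, y, k) (edges G)) with (edge G x y k).
    rewrite edge_out, Nat.eqb_eq. split.
    + intros H. assert (x = u) by (destruct (out L u); simpl in H; intuition congruence).
      subst; auto.
    + intros [[_ H] ->]; auto.
Qed.

Lemma indeg_eq v : v < n -> indeg G v = length (ilist v (inn L v)).
Proof.
  intros Hv. unfold indeg. apply length_filter_eq.
  - eapply NoDup_map_inv, edges_NoDup.
  - destruct (inn L v); simpl; repeat constructor; simpl; try tauto. intros [E|[]]. congruence.
  - intros [[x y] k]. change (In (x, y, k) (edges G)) with (edge G x y k).
    rewrite edge_in, Nat.eqb_eq. split.
    + intros H. assert (y = v) by (destruct (inn L v); simpl in H; intuition congruence).
      subst; auto.
    + intros [[_ H] ->]; auto.
Qed.

Lemma cedge_fun u v w : cedge G u v -> cedge G u w -> v = w.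
Proof.
  intros [_ H1]%edge_out [_ H2]%edge_out.
  destruct (out L u); simpl in H1, H2; intuition congruence.
Qed.

Lemma cedge_inj u v w : cedge G u w -> cedge G v w -> u = v.
Proof.
  intros [_ H1]%edge_in [_ H2]%edge_in.
  destruct (inn L w); simpl in H1, H2; intuition congruence.
Qed.

Lemma creach_le u v : creach G u v -> u <= v.
Proof.
  induction 1; try lia. apply edge_lt in H. lia.
Qed.

Lemma creach_reach u v : creach G u v -> reach G u v.
Proof.
  induction 1; [apply rt_step; now exists Cont | apply rt_refl | eapply rt_trans; eauto].
Qed.

Lemma creach_no_out u v : creach G u v -> (forall w, ~ cedge G u w) -> u = v.
Proof.
  intros H N. apply clos_rt_rt1n in H. destruct H; auto. now apply N in H.
Qed.

Lemma creach_no_in u v : creach G u v -> (forall w, ~ cedge G w v) -> u = v.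
Proof.
  intros H N. apply clos_rt_rtn1 in H. destruct H; auto. now apply N in H.
Qed.

(** Continuation edges are functional, so two paths from one node are comparable; this makes the
    last node of a thread unique. *)
Lemma creach_linear u v w : creach G u v -> creach G u w -> creach G v w \/ creach G w v.
Proof.
  intros H. apply clos_rt_rt1n in H. induction H as [|u x v H H0 IH]; intros H'; auto.
  apply clos_rt_rt1n in H'. inversion H' as [|y z H1 H2]; subst.
  - right. apply clos_rt1n_rt. econstructor; eauto.
  - rewrite (cedge_fun _ _ _ H H1) in *. apply IH. now apply clos_rt1n_rt.
Qed.

(** The local tables do not tell where threads lead; [main] and [forks] supply these global facts.
    In [forks], [l] ends the future thread, [l + d] is its touch, and [l + d - 1] is the local
    parent of that touch. *)
Hypothesis main : creach G 0 (n - 1).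
Hypothesis forks : forall u r, u < n -> out L u = Fork r ->
  exists l d, creach G (u + 1) l /\ out L l = Touching d /\ reach G (u + r) (l + d - 1).

Lemma creach_bound u v : u < n -> creach G u v -> v < n.
Proof. induction 2; auto. apply edge_lt in H0. lia. Qed.

Lemma main_last v : thread_last G v -> in_main G v -> v = n - 1.
Proof.
  intros [_ H1] H2. destruct (creach_linear _ _ _ H2 main) as [H|H].
  - now apply creach_no_out in H.
  - symmetry. apply creach_no_out in H; auto. intros w [_ H3]%edge_out.
    rewrite (wf_stop _ _ W) in H3. destruct H3.
Qed.

Lemma comp_of_is_fp : is_fp_comp G.
Proof.
  pose proof (wf_size _ _ W) as N.
  (* Only the final node is a [Stop], and forks and [Next] nodes have a continuation edge, so every
     other thread ends in a touch edge. *)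
  assert (TL : forall u, thread_last G u -> u < n - 1 -> exists d, out L u = Touching d).
  { intros u [_ H] Hu. pose proof (out_cases u ltac:(lia)) as O.
    destruct (out L u) eqn:EO; [..|lia].
    - exfalso. apply (H (u + r)). apply edge_out. rewrite EO. simpl. split; [lia|tauto].
    - exfalso. apply (H (u + 1)). apply edge_out. rewrite EO. simpl. split; [lia|tauto].
    - eauto. }
  repeat split; try (simpl; lia).
  - apply edge_lt in H. simpl. lia.
  - apply edge_lt in H. simpl. lia.
  - apply edges_NoDup.
  - intros v H. assert (T : forall u w, clos_trans nat (step G) u w -> u < w).
    { induction 1; [apply step_lt in H0|]; lia. }
    apply T in H. lia.
  - rewrite indeg_eq by (simpl; lia). simpl. now rewrite (wf_root _ _ W).
  - rewrite outdeg_eq by (simpl; lia). simpl. now rewrite (wf_stop _ _ W).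
  - rewrite indeg_eq by auto. pose proof (in_cases v H) as I.
    destruct (inn L v); simpl in *; lia.
  - rewrite indeg_eq by auto. destruct (inn L v); simpl in *; lia.
  - rewrite outdeg_eq by auto. pose proof (out_cases v H) as I.
    destruct (out L v); simpl in *; lia.
  - rewrite outdeg_eq by auto. destruct (out L v); simpl in *; lia.
  - apply cedge_fun.
  - apply cedge_inj.
  - apply main.
  - intros h [Hh H] Hr. simpl in *. pose proof (in_cases h Hh) as I.
    destruct (inn L h) eqn:EI.
    + lia.
    + exists (h - 1). apply edge_in. rewrite EI. simpl. auto.
    + exfalso. apply (H (h - r)). apply edge_in. rewrite EI. simpl. auto.
    + exfalso. apply (H (h - 1)). apply edge_in. rewrite EI. simpl. auto.
  - intros u H1. apply edge_in in H as [_ H]. apply edge_in in H1 as [_ H1].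
    destruct (inn L l); simpl in H, H1; intuition congruence.
  - assert (NC : forall u, ~ cedge G u l).
    { intros u H1. apply edge_in in H as [_ H]. apply edge_in in H1 as [_ H1].
      destruct (inn L l); simpl in H, H1; intuition congruence. }
    pose proof (edge_lt _ _ _ H) as Hl.
    intros [Q|Q].
    + apply creach_no_in in Q; auto. lia.
    + apply creach_le in Q. lia.
  - pose proof (edge_lt _ _ _ H) as Hl. apply edge_out in H as [Hv H].
    pose proof (out_cases v Hv) as O. destruct (out L v) eqn:EO; simpl in H;
      try (intuition congruence).
    destruct H as [H|[H|[]]]; [injection H as <-|discriminate].
    destruct O as (O1 & O2 & O3 & O4). exists (v + r). repeat split.
    + apply edge_out. rewrite EO. simpl. auto.
    + rewrite indeg_eq by lia. now rewrite O3.
    + rewrite indeg_eq by lia. now rewrite O4.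
    + intros x [_ Hx]%edge_in. rewrite O3 in Hx. simpl in Hx. intuition congruence.
    + intros x [_ Hx]%edge_in. rewrite O4 in Hx. simpl in Hx. intuition congruence.
  - assert (u <> n - 1) by (intros ->; now apply H0).
    destruct (TL u H) as [d E]; [destruct H; simpl in *; lia|].
    rewrite outdeg_eq by apply H. now rewrite E.
  - assert (u <> n - 1) by (intros ->; now apply H0).
    destruct (TL u H) as [d E]; [destruct H; simpl in *; lia|].
    exists (u + d). apply edge_out. rewrite E. simpl. split; auto. apply H.
  - apply edge_lt in H. simpl. lia.
  - intros w Hw. apply edge_out in H as [_ H], Hw as [_ Hw].
    destruct (out L v1); simpl in H, Hw; intuition congruence.
  - assert (TLv : thread_last G v1).
    { split; [apply edge_lt in H; simpl; lia|].
      intros w Hw. apply edge_out in H as [_ H], Hw as [_ Hw].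
      destruct (out L v1); simpl in H, Hw; intuition congruence. }
    intros Q. apply main_last in Q; auto. apply edge_lt in H. lia.
  - assert (TLv : forall w, ~ cedge G v1 w).
    { intros w Hw. apply edge_out in H as [_ H], Hw as [_ Hw].
      destruct (out L v1); simpl in H, Hw; intuition congruence. }
    apply edge_lt in H. intros [Q|Q].
    + apply creach_no_out in Q; auto. lia.
    + apply creach_le in Q. lia.
  - exists (v2 - 1). pose proof (edge_lt _ _ _ H) as Hl. apply edge_in in H as [Hv H].
    apply edge_in. split; auto.
    destruct (inn L v2); simpl in H |- *; intuition congruence.
Qed.

(** A path from the right child to the local parent of the touch gives both descendant conditions:
    prepend the edge from the fork, or append the edge to the touch. *)
Lemma comp_of_single_touch : structured_single_touch G.
Proof.
  assert (K : forall v h, edge G v h Fut -> exists r v2, cedge G v r /\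
    (forall w, is_touch_of G h w <-> w = v2) /\
    (forall u2, cedge G u2 v2 -> reach G r u2) /\ exists u2, cedge G u2 v2).
  { intros v h H. apply edge_out in H as [Hv H].
    destruct (out L v) eqn:EO; simpl in H; try (intuition congruence).
    destruct H as [H|[H|[]]]; [injection H as <-|discriminate].
    destruct (forks v r Hv EO) as (l & d & C1 & C2 & C3).
    pose proof (out_cases v Hv) as O. rewrite EO in O.
    assert (Hl : l < n) by (eapply creach_bound; [|eauto]; lia).
    pose proof (out_cases l Hl) as O2. rewrite C2 in O2.
    pose proof (in_cases (l + d) ltac:(lia)) as I. destruct O2 as (O2 & O3 & O4).
    rewrite O4 in I. destruct I as (I1 & I2 & I3).
    assert (CE : cedge G (l + d - 1) (l + d)).
    { apply edge_in. rewrite O4. simpl. split; [lia|auto]. }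
    exists (v + r), (l + d). repeat split.
    - apply edge_out. rewrite EO. simpl. auto.
    - intros (v1 & Q1 & Q2).
      assert (v1 = l).
      { destruct (creach_linear _ _ _ C1 Q1) as [Q|Q].
        - symmetry. apply creach_no_out in Q; auto. intros z [_ Hw]%edge_out.
          rewrite C2 in Hw. simpl in Hw. intuition congruence.
        - apply creach_no_out in Q; auto. intros z [_ Hw]%edge_out.
          apply edge_out in Q2 as [_ Q2].
          destruct (out L v1); simpl in Hw, Q2; intuition congruence. }
      subst. apply edge_out in Q2 as [_ Q2]. rewrite C2 in Q2. simpl in Q2. intuition congruence.
    - intros ->. exists l. split; auto. apply edge_out. rewrite C2. simpl. auto.
    - intros u2 Hu2. now rewrite (cedge_inj _ _ _ Hu2 CE).
    - eauto. }
  split; [split|].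
  - apply comp_of_is_fp.
  - intros v h H. destruct (K v h H) as (r & v2 & K1 & K2 & K3 & u2 & K4). split.
    + intros w u Hw Hu. apply K2 in Hw; subst. eapply rt_trans; [|now apply K3].
      apply rt_step. now exists Cont.
    + exists r, v2. repeat split; auto. now apply K2.
      eapply rt_trans; [apply K3; eauto|]. apply rt_step. now exists Cont.
  - intros v h H. destruct (K v h H) as (r & v2 & K1 & K2 & K3 & u2 & K4).
    exists v2. repeat split; [now apply K2|intros; now apply K2|].
    intros r' Hr. rewrite <- (cedge_fun _ _ _ K1 Hr).
    eapply rt_trans; [apply K3; eauto|]. apply rt_step. now exists Cont.
Qed.
End Layout.

(** * Spans and execution steps *)

(** The span is only bounded, never computed. Path lengths are bounded, so replacing a path by a
    longer one must stop; whether a longer one exists is decided classically. *)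
Lemma span_exists G N l0 :
  is_path G l0 -> (forall l, is_path G l -> length l <= N) ->
  exists s, has_span G s /\ length l0 <= S s <= N.
Proof.
  intros P0 B. remember (N - length l0) as m eqn:Em. revert l0 P0 Em.
  induction m as [m IH] using lt_wf_ind. intros l0 P0 ->.
  destruct (classic (exists l, is_path G l /\ length l0 < length l)) as [[l [Pl Ll]]|H].
  - specialize (B l Pl) as Bl.
    destruct (IH (N - length l) ltac:(lia) l Pl eq_refl) as [s [H1 H2]].
    exists s. split; auto. lia.
  - destruct l0 as [|x l0]; [destruct P0|]. exists (length l0). repeat split.
    + exists (x :: l0). auto.
    + intros l Pl. destruct (le_lt_dec (length l) (length (x :: l0))); auto.
      exfalso; eauto.
    + simpl; lia.
    + apply (B _ P0).
Qed.

Lemma path_length_le G (dep : nat -> nat) N :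
  (forall u v, step G u v -> dep u < dep v <= N) ->
  forall l, is_path G l -> length l <= S N.
Proof.
  intros H l. destruct l as [|x l]; [simpl; lia|].
  assert (Q : forall l x, is_path G (x :: l) -> length l = 0 \/ dep x + length l <= N).
  { clear x l. induction l as [|y l IH]; intros x Hp; [simpl; lia|].
    destruct Hp as [Hs Hp]. specialize (H _ _ Hs). destruct (IH _ Hp); simpl; lia. }
  intros Hp. specialize (Q _ _ Hp). simpl. lia.
Qed.

Lemma upd_eq {A} (f : nat -> A) p x : upd f p x p = x.
Proof. unfold upd. now rewrite Nat.eqb_refl. Qed.

Lemma upd_neq {A} (f : nat -> A) p x q : q <> p -> upd f p x q = f q.
Proof. unfold upd. intros H. now apply Nat.eqb_neq in H as ->. Qed.

Lemma upd_same {A} (f : nat -> A) p x : f p = x -> upd f p x = f.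
Proof.
  intros H. extensionality q. destruct (Nat.eq_dec q p) as [->|N].
  - now rewrite upd_eq.
  - now apply upd_neq.
Qed.

Lemma upd_upd {A} (f : nat -> A) p x y : upd (upd f p x) p y = upd f p y.
Proof.
  extensionality q. destruct (Nat.eq_dec q p) as [->|N].
  - now rewrite !upd_eq.
  - now rewrite !upd_neq.
Qed.

Lemma run_app G P s1 E1 s2 E2 s3 :
  ws_run G P s1 E1 s2 -> ws_run G P s2 E2 s3 -> ws_run G P s1 (E1 ++ E2) s3.
Proof.
  induction 1; intros H3; simpl; auto.
  - eapply run_exec; eauto.
  - eapply run_sched; eauto.
Qed.

Lemma run_one G P s p v s1 : ws_step G P s (Some (p, v)) s1 -> ws_run G P s [(p, v)] s1.
Proof. intros H. eapply run_exec; eauto. constructor. Qed.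

Lemma run_idle G P s s1 : ws_step G P s None s1 -> ws_run G P s [] s1.
Proof. intros H. eapply run_sched; eauto. constructor. Qed.

Lemma step_done G P s o s1 : ws_step G P s o s1 ->
  match o with
  | Some (p, v) => done s1 = v :: done s /\ ~ In v (done s)
  | None => done s1 = done s
  end.
Proof. destruct 1; simpl; auto. Qed.

(** For comparing complete executions: after all nodes are done a run may still contain scheduling
    actions, but no node is executed twice. *)
Lemma run_all_done G P s E s1 n :
  ws_run G P s E s1 -> (forall v, v < n -> In v (done s)) ->
  (forall v, In v (map snd E) -> v < n) -> E = [].
Proof.
  induction 1 as [|s p v s1 E s2 H1 H2 IH|s s1 E s2 H1 H2 IH]; intros H3 H4; auto.
  - apply step_done in H1 as [_ []]. apply H3, H4. now left.
  - apply step_done in H1. apply IH; auto. now rewrite H1.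
Qed.

(** * Scheduler steps on a layout, and determinism for one processor *)

Section Execution.
Variables (n : nat) (L : layout) (W : wf n L).
Let G := comp_of n L.

Lemma ready_inn D v : v < n ->
  match inn L v with
  | Root => True
  | Spawned => In (v - 1) D
  | RightOf r => In (v - r) D
  | Join d => In (v - 1) D /\ In (v - d) D
  end <-> ready G D v.
Proof.
  intros Hv. unfold ready, step. split.
  - intros H u [k [_ E]%(edge_in n L W)]. destruct (inn L v); simpl in E.
    + destruct E.
    + destruct E as [E|[]]. now injection E as <- <-.
    + destruct E as [E|[]]. now injection E as <- <-.
    + destruct E as [E|[E|[]]]; injection E as <- <-; apply H.
  - intros H.
    assert (K : forall u k, In (u, v, k) (ilist v (inn L v)) -> In u D).
    { intros u k E. apply H. exists k. now apply (edge_in n L W). }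
    destruct (inn L v); simpl in K; [auto|..].
    + eapply K; eauto.
    + eapply K; eauto.
    + split; eapply K; eauto.
Qed.

Lemma exec_fork P c d D p v r :
  p < P -> c p = Some v -> v < n -> ~ In v D -> ready G D v -> out L v = Fork r ->
  ws_step G P (mkS c d D) (Some (p, v))
    (mkS (upd c p (Some (v + 1))) (upd d p ((v + r) :: d p)) (v :: D)).
Proof.
  intros. apply (st_fork G P (mkS c d D)); auto;
    apply (edge_out n L); rewrite H4; simpl; auto.
Qed.

Lemma step_out v c : v < n -> step G v c <->
  match out L v with
  | Fork r => c = v + 1 \/ c = v + r
  | Next => c = v + 1
  | Touching d => c = v + d
  | Stop => False
  end.
Proof.
  intros Hv. unfold step. split.
  - intros [k [_ E]%(edge_out n L)]. destruct (out L v); simpl in E; intuition congruence.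
  - intros E.
    assert (K : forall k, In (v, c, k) (elist v (out L v)) -> exists k, edge G v c k).
    { intros k Hk. exists k. now apply (edge_out n L). }
    destruct (out L v); [destruct E as [->| ->]|..]; subst; simpl in K; eauto. tauto.
Qed.

Lemma exec_next P c d D p v e :
  p < P -> c p = Some v -> v < n -> ~ In v D -> ready G D v -> out L v = Next ->
  inn L (v + 1) = Join e -> In (v + 1 - e) D ->
  ws_step G P (mkS c d D) (Some (p, v)) (mkS (upd c p (Some (v + 1))) d (v :: D)).
Proof.
  intros H H0 H1 H2 H3 H4 H5 H6. apply (st_one_ready G P (mkS c d D)); auto.
  - unfold G. rewrite (outdeg_eq n L W) by auto. now rewrite H4.
  - apply step_out; auto. now rewrite H4.
  - pose proof (out_cases n L W v H1) as O. rewrite H4 in O.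
    apply ready_inn; [lia|]. rewrite H5. simpl. split; auto. left; lia.
Qed.

Lemma exec_next_wait P c d D p v e :
  p < P -> c p = Some v -> v < n -> ~ In v D -> ready G D v -> out L v = Next ->
  inn L (v + 1) = Join e -> ~ In (v + 1 - e) D ->
  ws_step G P (mkS c d D) (Some (p, v)) (mkS (upd c p None) d (v :: D)).
Proof.
  intros H H0 H1 H2 H3 H4 H5 H6. apply (st_one_wait G P (mkS c d D)) with (c := v + 1); auto.
  - unfold G. rewrite (outdeg_eq n L W) by auto. now rewrite H4.
  - apply step_out; auto. now rewrite H4.
  - pose proof (out_cases n L W v H1) as O. rewrite H4 in O.
    pose proof (in_cases n L W (v + 1) ltac:(lia)) as I. rewrite H5 in I.
    rewrite <- ready_inn by lia. rewrite H5. simpl. intros [_ [Q|Q]]; [lia|auto].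
Qed.

Lemma exec_touch P c d D p v e :
  p < P -> c p = Some v -> v < n -> ~ In v D -> ready G D v -> out L v = Touching e ->
  In (v + e - 1) D ->
  ws_step G P (mkS c d D) (Some (p, v)) (mkS (upd c p (Some (v + e))) d (v :: D)).
Proof.
  intros H H0 H1 H2 H3 H4 H5. apply (st_one_ready G P (mkS c d D)); auto.
  - unfold G. rewrite (outdeg_eq n L W) by auto. now rewrite H4.
  - apply step_out; auto. now rewrite H4.
  - pose proof (out_cases n L W v H1) as O. rewrite H4 in O.
    apply ready_inn; [lia|]. destruct O as (O1 & O2 & ->). simpl. split; auto. left; lia.
Qed.

Lemma exec_touch_wait P c d D p v e :
  p < P -> c p = Some v -> v < n -> ~ In v D -> ready G D v -> out L v = Touching e ->
  ~ In (v + e - 1) D ->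
  ws_step G P (mkS c d D) (Some (p, v)) (mkS (upd c p None) d (v :: D)).
Proof.
  intros H H0 H1 H2 H3 H4 H5. apply (st_one_wait G P (mkS c d D)) with (c := v + e); auto.
  - unfold G. rewrite (outdeg_eq n L W) by auto. now rewrite H4.
  - apply step_out; auto. now rewrite H4.
  - pose proof (out_cases n L W v H1) as O. rewrite H4 in O. destruct O as (O1 & O2 & O3).
    rewrite <- ready_inn by lia. rewrite O3. simpl. intros [[Q|Q] _]; [lia|auto].
Qed.

Lemma exec_stop P c d D p v :
  p < P -> c p = Some v -> v < n -> ~ In v D -> ready G D v -> out L v = Stop ->
  ws_step G P (mkS c d D) (Some (p, v)) (mkS (upd c p None) d (v :: D)).
Proof.
  intros. apply (st_last G P (mkS c d D)); auto.
  unfold G. rewrite (outdeg_eq n L W) by auto. now rewrite H4.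
Qed.

(** A lone processor has no victim to steal from. Its current node fixes the action through the
    out-degree and the readiness of the child; when idle it can only pop. *)
Lemma step_seq_det s o1 s1 o2 s2 :
  ws_step G 1 s o1 s1 -> ws_step G 1 s o2 s2 -> o1 = o2 /\ s1 = s2.
Proof.
  assert (F : forall v l r, edge G v l Fut -> cedge G v r -> outdeg G v = 2).
  { intros v l r [Hv H]%(edge_out n L) _. unfold G. rewrite (outdeg_eq n L W) by auto.
    destruct (out L v); simpl in H; intuition congruence. }
  assert (U : forall v l l', edge G v l Fut -> edge G v l' Fut -> l = l').
  { intros v l l' [_ H]%(edge_out n L) [_ H']%(edge_out n L).
    destruct (out L v); simpl in H, H'; intuition congruence. }
  assert (U1 : forall v c c', outdeg G v = 1 -> step G v c -> step G v c' -> c = c').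
  { intros v c c' Hd [k H] [k' H']. apply (edge_out n L) in H as [Hv H], H' as [_ H'].
    unfold G in Hd. rewrite (outdeg_eq n L W) in Hd by auto.
    destruct (out L v); simpl in Hd, H, H'; intuition congruence. }
  assert (U2 : forall v, outdeg G v = 0 -> forall c, ~ step G v c).
  { intros v Hd c [k H]. apply (edge_out n L) in H as [Hv H].
    unfold G in Hd. rewrite (outdeg_eq n L W) in Hd by auto.
    destruct (out L v); simpl in Hd, H; intuition congruence. }
  assert (P0 : forall p, p < 1 -> p = 0) by lia.
  intros H1 H2.
  destruct H1 as [s p v l r p1 C1 ? ? E1 E2|s p v c p1 C1 ? ? E1 E2 E3|s p v c p1 C1 ? ? E1 E2 E3
    |s p v p1 C1 ? ? E1|s p x rest p1 C1 D1|s p q xs x p1 q1 N C1 D1 D2]; [..|lia];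
  inversion H2 as [s' p' v' l' r' p2 C2 ? ? E1' E2'|s' p' v' c' p2 C2 ? ? E1' E2' E3'
    |s' p' v' c' p2 C2 ? ? E1' E2' E3'
    |s' p' v' p2 C2 ? ? E1'|s' p' x' rest' p2 C2 D1'|s' p' q' xs' x' p2 q2 N' C2 D1' D2'];
  subst s' o2 s2; try lia;
  apply P0 in p1, p2; subst p p'; rewrite C1 in C2; try discriminate C2;
  try (injection C2 as <-);
  try (pose proof (F _ _ _ E1 E2)); try (pose proof (F _ _ _ E1' E2')); try congruence;
  try (exfalso; eapply U2; eauto; fail).
  - rewrite (U _ _ _ E1 E1'), (cedge_fun n L _ _ _ E2 E2'). auto.
  - rewrite (U1 _ _ _ E1 E2 E2'). auto.
  - exfalso. rewrite (U1 _ _ _ E1 E2 E2') in *. tauto.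
  - exfalso. rewrite (U1 _ _ _ E1 E2 E2') in *. tauto.
  - auto.
  - auto.
  - rewrite D1 in D1'. injection D1' as <- <-. auto.
Qed.

(** One explicit run stands for all sequential executions. It ends idle with an empty deque, where
    no action is possible, so by determinism every complete run has its trace. *)
Lemma sequential_unique s E0 s0 :
  ws_run G 1 s E0 s0 -> cur s0 0 = None -> dq s0 0 = [] ->
  (forall v, In v (map snd E0) -> v < n) ->
  forall E s1, ws_run G 1 s E s1 -> (forall v, v < n -> In v (done s1)) -> E = E0.
Proof.
  intros R C0 D0. induction R as [s|s p v s' E0 s2 St R IH|s s' E0 s2 St R IH];
    intros HE E s1 R1 Hd.
  - assert (N : forall o s', ~ ws_step G 1 s o s').
    { intros o s' H. inversion H; subst; try lia; assert (p = 0) by lia; subst; congruence. }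
    inversion R1; subst; auto; exfalso; eapply N; eauto.
  - inversion R1; subst.
    + exfalso. apply step_done in St as [_ []]. apply Hd, HE. now left.
    + destruct (step_seq_det _ _ _ _ _ St H) as [E1 ->]. injection E1 as <- <-. f_equal.
      eapply IH; eauto. intros; apply HE; now right.
    + destruct (step_seq_det _ _ _ _ _ St H) as [E1 ->]. discriminate.
  - inversion R1; subst.
    + symmetry. eapply run_all_done; [exact R| |exact HE].
      apply step_done in St. now rewrite St.
    + destruct (step_seq_det _ _ _ _ _ St H) as [E1 ->]. discriminate.
    + destruct (step_seq_det _ _ _ _ _ St H) as [E1 ->]. eapply IH; eauto.
Qed.
End Execution.

(** * Deviations and LRU misses *)

(* Only nodes adjacent in the trace are compared, which gives a lower bound for the deviations
   from the sequential execution [0, 1, 2, ...]. *)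
Fixpoint devl (E : list (nat * nat)) : list nat :=
  match E with
  | [] => []
  | (p, u) :: E' =>
      match E' with
      | [] => []
      | (q, w) :: _ =>
          if (Nat.eqb p q && negb (Nat.eqb w (u + 1)) && negb (Nat.eqb w 0))%bool
          then w :: devl E' else devl E'
      end
  end.

Lemma devl_cons2 p u q w E : devl ((p, u) :: (q, w) :: E) =
  if (Nat.eqb p q && negb (Nat.eqb w (u + 1)) && negb (Nat.eqb w 0))%bool
  then w :: devl ((q, w) :: E) else devl ((q, w) :: E).
Proof. reflexivity. Qed.

Lemma devl_incl E w : In w (devl E) -> In w (map snd (tl E)).
Proof.
  induction E as [|[p u] [|[q x] E] IH]; auto; intros H.
  rewrite devl_cons2 in H.
  destruct (_ && _)%bool.
  - destruct H as [<-|H]; [now left|]. right. apply IH, H.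
  - right. apply IH, H.
Qed.

Lemma devl_NoDup E : NoDup (map snd E) -> NoDup (devl E).
Proof.
  induction E as [|[p u] [|[q x] E] IH]; intros H; try constructor.
  rewrite devl_cons2. inversion H; subst.
  destruct (_ && _)%bool; auto. constructor; auto.
  intros Q. apply devl_incl in Q. simpl in Q. inversion H3; subst. auto.
Qed.

(** Without repetitions [w] has a single entry in the table, and when the same processor executed
    the preceding node of the trace, that node is the recorded one. *)
Lemma devl_lookup E last w :
  NoDup (map snd E) -> In w (devl E) ->
  w <> 0 /\ exists u, w <> u + 1 /\ lookup (prev_table E last) w = Some (Some u).
Proof.
  revert last. induction E as [|[p u] [|[q x] E] IH]; intros last ND H; try (destruct H; fail).
  rewrite devl_cons2 in H. inversion ND; subst.
  assert (Hw : In w (map snd ((q, x) :: E)) -> u <> w) by (intros ? ->; auto).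
  assert (K : In w (devl ((q, x) :: E)) -> w <> 0 /\ exists u0, w <> u0 + 1 /\
     lookup (prev_table ((p, u) :: (q, x) :: E) last) w = Some (Some u0)).
  { intros Q. destruct (IH (upd last p (Some u)) H3 Q) as [K1 [v [K2 K3]]]. split; auto.
    exists v. split; auto.
    change (prev_table ((p, u) :: (q, x) :: E) last)
      with ((u, last p) :: prev_table ((q, x) :: E) (upd last p (Some u))).
    cbn [lookup]. destruct (Nat.eqb_spec u w); auto. exfalso. apply Hw; auto.
    right. apply devl_incl in Q. exact Q. }
  destruct (Nat.eqb_spec p q); destruct (Nat.eqb_spec x (u + 1));
    destruct (Nat.eqb_spec x 0); cbn [andb negb] in H; auto.
  destruct H as [<-|H]; auto. split; auto. exists u. split; auto. subst.
  assert (u <> x) by (apply Hw; now left).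
  simpl. apply Nat.eqb_neq in H as ->. now rewrite Nat.eqb_refl, upd_eq.
Qed.

Lemma combine_seq_succ a n : combine (seq a (S n)) (tl (seq a (S n))) =
  map (fun i => (i, S i)) (seq a n).
Proof.
  revert a. induction n as [|n IH]; intros a; auto.
  specialize (IH (S a)). cbn [seq tl combine map] in *. f_equal.
  exact IH.
Qed.

(** The pairs examined by [deviations] are [(w - 1, w)] with [0 < w < n], so each [w] in [devl]
    accounts for its own pair. This is why [devl] skips node 0, which has no sequential
    predecessor. *)
Lemma deviations_ge n E : NoDup (map snd E) -> (forall v, In v (map snd E) -> v < n) ->
  length (devl E) <= deviations (seq 0 n) E.
Proof.
  intros ND H. unfold deviations. destruct n as [|n].
  { destruct E as [|[p u] E]; auto. specialize (H u (or_introl eq_refl)). lia. }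
  rewrite combine_seq_succ, <- (length_map (fun w => (w - 1, w))).
  apply NoDup_incl_length.
  - apply FinFun.Injective_map_NoDup; [|now apply devl_NoDup].
    intros a b Q. congruence.
  - intros e He. apply in_map_iff in He as [w [<- Hw]].
    destruct (devl_lookup E (fun _ => None) w ND Hw) as [K1 [u [K2 K3]]].
    apply filter_In. split.
    + apply in_map_iff. exists (w - 1). split; [f_equal; lia|]. apply in_seq.
      apply devl_incl in Hw.
      assert (In w (map snd E)) by (destruct E; [destruct Hw|right; auto]).
      apply H in H0. lia.
    + simpl. unfold is_deviation. rewrite K3. apply Bool.negb_true_iff, Nat.eqb_neq. lia.
Qed.

Lemma devl_app E1 E2 : length (devl E1) + length (devl E2) <= length (devl (E1 ++ E2)).
Proof.
  induction E1 as [|[p u] E1 IH]; auto.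
  destruct E1 as [|[q x] E1].
  - simpl. destruct E2 as [|[q x] E2]; auto. destruct (_ && _)%bool; simpl; lia.
  - change (((p, u) :: (q, x) :: E1) ++ E2) with ((p, u) :: (q, x) :: E1 ++ E2).
    rewrite !devl_cons2. cbn [app] in IH. destruct (_ && _)%bool; cbn [length]; lia.
Qed.

Lemma devl_cons e E : length (devl E) <= length (devl (e :: E)).
Proof. pose proof (devl_app [e] E) as H. simpl app in H. lia. Qed.

Lemma devl_app_l E1 E2 : length (devl E1) <= length (devl (E1 ++ E2)).
Proof. pose proof (devl_app E1 E2). lia. Qed.

Lemma devl_app_r E1 E2 : length (devl E2) <= length (devl (E1 ++ E2)).
Proof. pose proof (devl_app E1 E2). lia. Qed.

(** * LRU caches and sweeps over one block more than fits *)

Fixpoint lru (C : nat) (c : list nat) (bs : list nat) : nat * list nat :=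
  match bs with
  | [] => (0, c)
  | b :: bs' =>
      let (m, c') := lru_access C c b in
      let (k, c'') := lru C c' bs' in ((if m then 1 else 0) + k, c'')
  end.

Lemma lru_app C c l1 l2 : lru C c (l1 ++ l2) =
  (fst (lru C c l1) + fst (lru C (snd (lru C c l1)) l2), snd (lru C (snd (lru C c l1)) l2)).
Proof.
  revert c. induction l1 as [|b l1 IH]; intros c; simpl.
  - now destruct (lru C c l2).
  - destruct (lru_access C c b) as [m c']. rewrite IH.
    destruct (lru C c' l1) as [k c'']. simpl. f_equal. lia.
Qed.

Lemma length_remove_in b c : In b c -> S (length (remove Nat.eq_dec b c)) <= length c.
Proof. intros H. apply (remove_length_lt Nat.eq_dec) in H. lia. Qed.

Lemma existsb_In b c : existsb (Nat.eqb b) c = true <-> In b c.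
Proof.
  rewrite existsb_exists. split.
  - intros [x [H E]]. apply Nat.eqb_eq in E. now subst.
  - intros H. exists b. split; auto. apply Nat.eqb_refl.
Qed.

Lemma lru_access_hit C c b : In b c -> lru_access C c b = (false, b :: remove Nat.eq_dec b c).
Proof. intros H. unfold lru_access. now apply existsb_In in H as ->. Qed.

Lemma lru_access_miss C c b : ~ In b c -> lru_access C c b = (true, firstn C (b :: c)).
Proof.
  intros H. unfold lru_access. destruct (existsb _ _) eqn:E; auto. now apply existsb_In in E.
Qed.

Lemma lru_access_length C c b : length c <= C -> length (snd (lru_access C c b)) <= C.
Proof.
  intros H. destruct (in_dec Nat.eq_dec b c) as [I|I].
  - rewrite lru_access_hit by auto. simpl. pose proof (length_remove_in _ _ I). lia.
  - rewrite lru_access_miss by auto. cbn [snd]. rewrite length_firstn. lia.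
Qed.

Lemma lru_length C c bs : length c <= C -> length (snd (lru C c bs)) <= C.
Proof.
  revert c. induction bs as [|b bs IH]; intros c H; auto. simpl.
  pose proof (lru_access_length C c b H) as H1. destruct (lru_access C c b) as [m c'].
  specialize (IH c' H1). now destruct (lru C c' bs).
Qed.

Lemma lru_le_length C c bs : fst (lru C c bs) <= length bs.
Proof.
  revert c. induction bs as [|b bs IH]; intros c; auto. simpl.
  destruct (lru_access C c b) as [m c']. specialize (IH c').
  destruct (lru C c' bs). simpl in *. destruct m; lia.
Qed.

Lemma remove_app_notin (b : nat) u r : ~ In b u ->
  remove Nat.eq_dec b (u ++ r) = u ++ remove Nat.eq_dec b r.
Proof. intros H. rewrite remove_app. now rewrite notin_remove. Qed.

(** Each access moves its block to the front, and up to [C] distinct blocks never evict one another,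
    whatever the cache held before. *)
Lemma lru_prefix C c u : length c <= C -> NoDup u -> length u <= C ->
  exists r, snd (lru C c u) = rev u ++ r.
Proof.
  intros Hc. induction u as [|b u IH] using rev_ind; intros ND Hu; [now exists c|].
  rewrite length_app in Hu. simpl in Hu.
  apply NoDup_remove in ND as [ND NI]. rewrite app_nil_r in ND, NI.
  destruct (IH ND ltac:(lia)) as [r Hr].
  rewrite lru_app, Hr, rev_app_distr. cbn [lru].
  destruct (in_dec Nat.eq_dec b (rev u ++ r)) as [I|I].
  - rewrite lru_access_hit by auto. cbn. rewrite remove_app_notin.
    + eauto.
    + now rewrite <- in_rev.
  - rewrite lru_access_miss by auto. cbn [snd rev app].
    exists (firstn (C - 1 - length u) r).
    destruct C as [|C']; [lia|]. cbn [firstn]. rewrite firstn_app, length_rev.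
    rewrite firstn_all2 by (rewrite length_rev; lia). simpl. do 3 f_equal. lia.
Qed.

Definition sweep C (w : list nat) := NoDup w /\ length w = S C.

Lemma sweep_rev C w : sweep C w -> sweep C (rev w).
Proof. intros [H1 H2]. split; [now apply NoDup_rev|now rewrite length_rev]. Qed.

Lemma sweep_snoc C w : sweep C w -> exists u b, w = u ++ [b] /\ NoDup u /\ ~ In b u /\ length u = C.
Proof.
  intros [ND H]. destruct (exists_last (l := w)) as [u [b ->]]; [intros ->; discriminate|].
  exists u, b. rewrite length_app in H. simpl in H.
  apply NoDup_remove in ND as [ND NI]. rewrite app_nil_r in ND, NI. repeat split; auto. lia.
Qed.

(** The first [C] blocks of a sweep flush the old contents, and the last block evicts the first one.
    The result does not depend on the initial cache, which makes consecutive sweeps composable. *)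
Lemma sweep_state C c w : 1 <= C -> length c <= C -> sweep C w ->
  snd (lru C c w) = rev (tl w).
Proof.
  intros C1 Hc Hw. destruct (sweep_snoc _ _ Hw) as (u & b & -> & ND & NI & Hu).
  destruct (lru_prefix C c u Hc ND ltac:(lia)) as [r Hr].
  assert (r = []).
  { pose proof (lru_length C c u Hc) as Q. rewrite Hr, length_app, length_rev in Q.
    destruct r; auto. simpl in Q. lia. }
  subst r. rewrite app_nil_r in Hr. rewrite lru_app, Hr. cbn [lru].
  rewrite lru_access_miss by now rewrite <- in_rev.
  destruct u as [|a u]; [simpl in Hu; lia|]. cbn [snd tl app rev].
  rewrite rev_app_distr. simpl in Hu |- *.
  destruct C as [|C']; [lia|]. simpl. f_equal.
  rewrite firstn_app, length_rev, firstn_all2 by (rewrite length_rev; lia).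
  replace (C' - length u) with 0 by lia. simpl. apply app_nil_r.
Qed.

(* The next block to be accessed is always the one evicted last. *)
Lemma sweep_again C w u v : 1 <= C -> sweep C w -> w = u ++ v -> v <> [] ->
  fst (lru C (rev u ++ rev (tl v)) v) = length v.
Proof.
  intros C1 Hw. revert u. induction v as [|b v IH]; intros u E NE; [congruence|].
  destruct Hw as [ND Hl]. rewrite E in ND, Hl. rewrite length_app in Hl. simpl in Hl.
  pose proof (NoDup_remove _ _ _ ND) as [ND' NI]. rewrite in_app_iff in NI.
  cbn [lru tl]. rewrite lru_access_miss
    by (rewrite in_app_iff, <- !in_rev; tauto).
  destruct v as [|b' v]; [simpl; auto|].
  replace (firstn C (b :: rev u ++ rev (b' :: v))) with (rev (u ++ [b]) ++ rev (tl (b' :: v))).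
  - rewrite (surjective_pairing (lru C _ _)). rewrite IH.
    + reflexivity.
    + now rewrite <- app_assoc.
    + discriminate.
  - rewrite rev_app_distr. simpl in Hl |- *. destruct C as [|C']; [lia|].
    simpl. f_equal. rewrite app_assoc, firstn_app, firstn_all2.
    + rewrite length_app, !length_rev. replace (C' - _) with 0 by lia. simpl.
      now rewrite app_nil_r.
    + rewrite length_app, !length_rev. lia.
Qed.

(** The first sweep is not counted, since it may hit blocks left by earlier work; it puts the cache
    into the state from which each repetition misses throughout. *)
Lemma sweeps_ge C c w q : 1 <= C -> length c <= C -> sweep C w ->
  (q - 1) * S C <= fst (lru C c (concat (repeat w q))).
Proof.
  intros C1 Hc Hw. destruct q as [|q]; [simpl; lia|]. replace (S q - 1) with q by lia.
  assert (K : forall q, q * S C <= fst (lru C (rev (tl w)) (concat (repeat w q)))).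
  { clear q. induction q as [|q IH]; [simpl; lia|].
    simpl repeat. simpl concat. rewrite lru_app. cbn [fst].
    rewrite (sweep_state C) by (auto; destruct Hw as [_ Hw]; rewrite length_rev;
      destruct w; simpl in Hw |- *; lia).
    pose proof (sweep_again C w [] w C1 Hw eq_refl) as Q.
    destruct Hw as [_ Hw]. rewrite Hw in Q. simpl rev in Q. simpl app in Q.
    rewrite Q; [lia|]. intros ->. discriminate. }
  simpl repeat. simpl concat. rewrite lru_app. cbn [fst]. rewrite sweep_state by auto.
  specialize (K q). lia.
Qed.

Lemma lru_hits C c u : (forall b, In b u -> In b c) -> fst (lru C c u) = 0.
Proof.
  revert c. induction u as [|b u IH]; intros c H; auto. cbn [lru].
  rewrite lru_access_hit by (apply H; now left).
  assert (Q : fst (lru C (b :: remove Nat.eq_dec b c) u) = 0).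
  { apply IH. intros x Hx. destruct (Nat.eq_dec x b) as [->|N]; [now left|right].
    apply in_in_remove; auto. apply H; now right. }
  now destruct (lru C _ u).
Qed.

(** After the sweep [w] only its first block is absent from the cache, and the reversed sweep comes
    to that block last. *)
Lemma sweep_back C w : fst (lru C (rev (tl w)) (rev w)) <= 1.
Proof.
  destruct w as [|b w]; [simpl; lia|]. simpl. rewrite lru_app. cbn [fst].
  rewrite lru_hits by auto. apply (lru_le_length C _ [b]).
Qed.

Lemma sweeps_le C w N : 1 <= C -> sweep C w ->
  fst (lru C [] (concat (repeat (w ++ rev w) N))) <= S C + 2 * N.
Proof.
  intros C1 Hw. pose proof (sweep_rev _ _ Hw) as Hr.
  assert (LT : forall w, sweep C w -> length (rev (tl w)) <= C).
  { intros x [_ H]. rewrite length_rev. destruct x; simpl in *; lia. }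
  assert (K : forall N, fst (lru C (rev (tl (rev w))) (concat (repeat (w ++ rev w) N))) <= 2 * N).
  { clear N. induction N as [|N IH]; [simpl; lia|].
    simpl repeat. simpl concat. rewrite !lru_app. cbn [fst snd].
    rewrite (sweep_state C _ w) by auto. rewrite (sweep_state C _ (rev w)) by auto.
    pose proof (sweep_back C w). pose proof (sweep_back C (rev w)) as B2.
    rewrite rev_involutive in B2. lia. }
  destruct N as [|N]; [simpl; lia|].
  simpl repeat. simpl concat. rewrite !lru_app. cbn [fst snd].
  rewrite (sweep_state C _ w) by (simpl; auto; lia).
  rewrite (sweep_state C _ (rev w)) by auto.
  pose proof (sweep_back C w). specialize (K N).
  pose proof (lru_le_length C [] w). destruct Hw as [_ Hw]. lia.
Qed.

(** * Accesses and misses of traces *)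

Definition accesses (m : nat -> option nat) (l : list nat) : list nat :=
  flat_map (fun v => match m v with Some b => [b] | None => [] end) l.

Lemma accesses_app m l1 l2 : accesses m (l1 ++ l2) = accesses m l1 ++ accesses m l2.
Proof. apply flat_map_app. Qed.

Lemma misses_aux_app G C E1 E2 caches : (forall p, length (caches p) <= C) ->
  exists caches', (forall p, length (caches' p) <= C) /\
  misses_aux G C (E1 ++ E2) caches = misses_aux G C E1 caches + misses_aux G C E2 caches'.
Proof.
  revert caches. induction E1 as [|[p v] E1 IH]; intros caches H; simpl.
  - eauto.
  - destruct (blk G v) as [b|].
    + pose proof (lru_access_length C (caches p) b (H p)) as Hb.
      destruct (lru_access C (caches p) b) as [m c'].
      destruct (IH (upd caches p c')) as (c2 & H1 & ->).
      * intros q. destruct (Nat.eq_dec q p) as [->|N]; [now rewrite upd_eq|now rewrite upd_neq].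
      * exists c2. split; auto. lia.
    + destruct (IH caches H) as (c2 & H1 & ->). eauto.
Qed.

Lemma misses_aux_single G C p l caches :
  misses_aux G C (map (pair p) l) caches = fst (lru C (caches p) (accesses (blk G) l)).
Proof.
  revert caches. induction l as [|v l IH]; intros caches; simpl; auto.
  destruct (blk G v) as [b|]; simpl; auto.
  destruct (lru_access C (caches p) b) as [m c']. rewrite IH, upd_eq.
  now destruct (lru C c' _).
Qed.

(** Quantifying over all initial caches makes bounds for segments of a trace add up, whichever
    processors run them and whatever they did before. *)
Definition misses_at_least G C E M :=
  forall caches, (forall p, length (caches p) <= C) -> M <= misses_aux G C E caches.

Lemma misses_at_least_app G C E1 E2 M1 M2 :
  misses_at_least G C E1 M1 -> misses_at_least G C E2 M2 ->
  misses_at_least G C (E1 ++ E2) (M1 + M2).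
Proof.
  intros H1 H2 caches H. destruct (misses_aux_app G C E1 E2 caches H) as (c' & Hc & ->).
  specialize (H1 _ H). specialize (H2 _ Hc). lia.
Qed.

Lemma misses_at_least_0 G C E : misses_at_least G C E 0.
Proof. intros ? ?. lia. Qed.

Lemma misses_at_least_sweeps G C p l w q : 1 <= C -> sweep C w ->
  accesses (blk G) l = concat (repeat w q) ->
  misses_at_least G C (map (pair p) l) ((q - 1) * S C).
Proof.
  intros C1 Hw E caches H. rewrite misses_aux_single, E. now apply sweeps_ge.
Qed.

(** * The grid and the tree of grids *)

(* [gV j] is the [j]-th fork of the spine, [gF j i] the [i]-th fork of row [j], [gE j] the node
   after row [j], last of its thread unless [j = 0] ([gE m] is the innermost thread, a single
   node), and [gY j] the touch of the last thread of row [j].  Rows are numbered outermost first, hence in the reverse of the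
   sequential order. *)
Inductive gnode := gV (j : nat) | gE (j : nat) | gF (j i : nat) | gX (j i : nat)
  | gT (j i : nat) | gY (j : nat).

Section Grid.
Variables (m k C : nat).

(* Position of [gE j].  The formulas of [pos] also give [gF j k = gE j] and [gV m = gE m], which
   makes the right child of the last fork of a row and the innermost thread uniform. *)
Definition base j := m + (m - j) * (3 * k + 1).

Definition pos x :=
  match x with
  | gV j => j
  | gE j => base j
  | gF j i => base (j + 1) + 1 + 3 * i
  | gX j i => base (j + 1) + 2 + 3 * i
  | gT j i => base (j + 1) + 3 + 3 * i
  | gY j => base 0 + 1 + j
  end.

Definition valid x :=
  match x with
  | gV j | gY j => j < m
  | gE j => j <= m
  | gF j i | gX j i | gT j i => j < m /\ i < k
  end.

Definition gsize := base 0 + 1 + m.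

(** Layout tables are functions of positions; this inverse of [pos] on valid nodes lets them be
    specified by node names. After the spine come [m] blocks of [3 * k + 1] nodes, each one [gE]
    followed by the triples of a row, and then [gE 0] with the [gY] chain. *)
Definition dec u :=
  if u <? m then gV u else
  let w := u - m in
  let a := w / (3 * k + 1) in
  let r := w mod (3 * k + 1) in
  if a <? m then
    match r with
    | 0 => gE (m - a)
    | S r' =>
        match r' mod 3 with
        | 0 => gF (m - 1 - a) (r' / 3)
        | 1 => gX (m - 1 - a) (r' / 3)
        | _ => gT (m - 1 - a) (r' / 3)
        end
    end
  else match w - m * (3 * k + 1) with 0 => gE 0 | S y => gY y end.

Lemma base_succ j : j < m -> base j = base (j + 1) + 3 * k + 1.
Proof.
  intros H. unfold base. replace (m - j) with (S (m - (j + 1))) by lia. simpl. lia.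
Qed.

Lemma base_m : base m = m.
Proof. unfold base. rewrite Nat.sub_diag. simpl. lia. Qed.

Lemma base_ge j : m <= base j.
Proof. unfold base. lia. Qed.

Lemma base_le j : base j <= base 0.
Proof. unfold base. nia. Qed.

Lemma divmod_eq a b q r : r < b -> a = b * q + r -> a / b = q /\ a mod b = r.
Proof. intros. split; symmetry; [eapply Nat.div_unique|eapply Nat.mod_unique]; eauto. Qed.

Lemma dec_row a r : a < m -> r < 3 * k + 1 ->
  dec (m + (a * (3 * k + 1) + r)) =
  match r with
  | 0 => gE (m - a)
  | S r' =>
      match r' mod 3 with
      | 0 => gF (m - 1 - a) (r' / 3)
      | 1 => gX (m - 1 - a) (r' / 3)
      | _ => gT (m - 1 - a) (r' / 3)
      end
  end.
Proof.
  intros Ha Hr. unfold dec. destruct (Nat.ltb_spec (m + (a * (3 * k + 1) + r)) m); [lia|].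
  replace (m + (a * (3 * k + 1) + r) - m) with (a * (3 * k + 1) + r) by lia.
  destruct (divmod_eq (a * (3 * k + 1) + r) (3 * k + 1) a r Hr ltac:(lia)) as [-> ->].
  apply Nat.ltb_lt in Ha as ->. reflexivity.
Qed.

Lemma dec_tail y : dec (m + (m * (3 * k + 1) + y)) = match y with 0 => gE 0 | S y => gY y end.
Proof.
  unfold dec. destruct (Nat.ltb_spec (m + (m * (3 * k + 1) + y)) m); [lia|].
  replace (m + (m * (3 * k + 1) + y) - m) with (m * (3 * k + 1) + y) by lia.
  destruct (Nat.ltb_spec ((m * (3 * k + 1) + y) / (3 * k + 1)) m) as [H1|_].
  - pose proof (Nat.div_mod (m * (3 * k + 1) + y) (3 * k + 1) ltac:(lia)).
    pose proof (Nat.mod_upper_bound (m * (3 * k + 1) + y) (3 * k + 1) ltac:(lia)). nia.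
  - replace (m * (3 * k + 1) + y - m * (3 * k + 1)) with y by lia. reflexivity.
Qed.

Lemma dec_pos x : valid x -> dec (pos x) = x.
Proof.
  assert (R : forall j i e, j < m -> i < k -> e < 3 ->
    dec (base (j + 1) + S e + 3 * i) =
    match e with 0 => gF j i | 1 => gX j i | _ => gT j i end).
  { intros j i e Hj Hi He. unfold base.
    replace (m + (m - (j + 1)) * (3 * k + 1) + S e + 3 * i)
      with (m + ((m - (j + 1)) * (3 * k + 1) + S (3 * i + e))) by lia.
    rewrite dec_row by lia.
    destruct (divmod_eq (3 * i + e) 3 i e He ltac:(lia)) as [-> ->].
    replace (m - 1 - (m - (j + 1))) with j by lia. reflexivity. }
  destruct x as [j|j|j i|j i|j i|j]; simpl; intros H.
  - unfold dec. now apply Nat.ltb_lt in H as ->.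
  - destruct (Nat.eq_dec j 0) as [->|N].
    + unfold base. rewrite Nat.sub_0_r, <- (Nat.add_0_r (m * (3 * k + 1))).
      now rewrite dec_tail.
    + unfold base. rewrite <- (Nat.add_0_r ((m - j) * (3 * k + 1))).
      rewrite dec_row by lia. f_equal. lia.
  - destruct H. apply (R j i 0); lia.
  - destruct H. apply (R j i 1); lia.
  - destruct H. apply (R j i 2); lia.
  - unfold base. rewrite Nat.sub_0_r.
    replace (m + m * (3 * k + 1) + 1 + j) with (m + (m * (3 * k + 1) + S j)) by lia.
    now rewrite dec_tail.
Qed.

Lemma node_cases u : u < gsize -> exists x, valid x /\ u = pos x.
Proof.
  unfold gsize. intros H. destruct (lt_dec u m) as [H1|H1]; [now exists (gV u)|].
  destruct (lt_dec u (base 0)) as [H2|H2].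
  - unfold base in H2. rewrite Nat.sub_0_r in H2.
    pose proof (Nat.div_mod (u - m) (3 * k + 1) ltac:(lia)) as D.
    pose proof (Nat.mod_upper_bound (u - m) (3 * k + 1) ltac:(lia)) as B.
    set (a := (u - m) / (3 * k + 1)) in *. set (r := (u - m) mod (3 * k + 1)) in *.
    assert (Ha : a < m) by nia.
    destruct r as [|r].
    + exists (gE (m - a)). simpl. split; [lia|]. unfold base.
      replace (m - (m - a)) with a by lia. lia.
    + pose proof (Nat.div_mod r 3 ltac:(lia)) as D2.
      pose proof (Nat.mod_upper_bound r 3 ltac:(lia)) as B2.
      set (i := r / 3) in *. set (e := r mod 3) in *.
      assert (Hb : base (m - 1 - a + 1) = m + a * (3 * k + 1)).
      { unfold base. f_equal. f_equal. lia. }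
      destruct e as [|[|[|e]]]; [| | |lia].
      * exists (gF (m - 1 - a) i). simpl pos. rewrite Hb. simpl. lia.
      * exists (gX (m - 1 - a) i). simpl pos. rewrite Hb. simpl. lia.
      * exists (gT (m - 1 - a) i). simpl pos. rewrite Hb. simpl. lia.
  - destruct (Nat.eq_dec u (base 0)) as [->|N].
    + exists (gE 0). simpl. lia.
    + exists (gY (u - base 0 - 1)). simpl. lia.
Qed.

Lemma pos_inj x y : valid x -> valid y -> pos x = pos y -> x = y.
Proof. intros Hx Hy E. rewrite <- (dec_pos x), <- (dec_pos y), E; auto. Qed.

Lemma pos_bound x : valid x -> pos x < gsize.
Proof.
  unfold gsize. pose proof (base_ge 0).
  destruct x as [j|j|j i|j i|j i|j]; simpl; intros Hx; try lia;
    try (destruct Hx as [Hx Hi]; pose proof (base_succ j Hx); pose proof (base_le j); lia).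
  pose proof (base_le j). lia.
Qed.

(** [gE (j + 1)] is placed just before row [j], so the same distance 3 leads from it to [gT j 0] and
    from [gT j i] to [gT j (i + 1)]. *)
Definition gout x :=
  match x with
  | gV j => Fork (base (j + 1) + 1 - j)
  | gE 0 => Next
  | gE (S _) => Touching 3
  | gF _ _ => Fork 3
  | gX _ _ => Next
  | gT j i => if i + 1 <? k then Touching 3
              else Touching (base 0 + 1 + j - (base (j + 1) + 3 + 3 * i))
  | gY j => if j + 1 <? m then Next else Stop
  end.

Definition ginn x :=
  match x with
  | gV 0 => Root
  | gV (S _) => Spawned
  | gE j => if j =? m then Spawned else RightOf 3
  | gF j 0 => RightOf (base (j + 1) + 1 - j)
  | gF j (S _) => RightOf 3
  | gX _ _ => Spawned
  | gT _ _ => Join 3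
  | gY j => Join (base 0 + 1 + j - (base (j + 1) + 3 + 3 * (k - 1)))
  end.

(* In the sequential order [X j 0, T j 0, X j 1, T j 1, ...] the accesses form alternating
   descending and ascending sweeps over the blocks [0 .. C]. *)
Definition gmem x :=
  match x with
  | gX j i => let r := i mod (2 * (C + 1)) in if r <=? C then Some (C - r) else None
  | gT j i => let r := i mod (2 * (C + 1)) in if r <=? C then None else Some (r - C - 1)
  | _ => None
  end.

(** A tree of height [h + 1] is a fork and a join around two copies of height [h]. The exit of the
    left copy ends a future thread that touches the join; the exit of the right copy continues into
    it. *)
Fixpoint size h :=
  match h with
  | 0 => gsize
  | S h => 2 * size h + 2
  end.

Fixpoint tout h u :=
  match h with
  | 0 => gout (dec u)
  | S h =>
      if u =? 0 then Fork (size h + 1)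
      else if u <? size h then tout h (u - 1)
      else if u =? size h then Touching (size h + 1)
      else if u <? 2 * size h then tout h (u - 1 - size h)
      else if u =? 2 * size h then Next else Stop
  end.

Fixpoint tinn h u :=
  match h with
  | 0 => ginn (dec u)
  | S h =>
      if u =? 0 then Root
      else if u =? 1 then Spawned
      else if u <=? size h then tinn h (u - 1)
      else if u =? size h + 1 then RightOf (size h + 1)
      else if u <=? 2 * size h then tinn h (u - 1 - size h)
      else Join (size h + 1)
  end.

Fixpoint tmem h u :=
  match h with
  | 0 => gmem (dec u)
  | S h =>
      if u =? 0 then None
      else if u <=? size h then tmem h (u - 1)
      else if u <=? 2 * size h then tmem h (u - 1 - size h)
      else None
  end.

Definition tree h := mkLayout (tout h) (tinn h) (tmem h).

Variable L : layout.

(* The first node of a block gets its parent, and the last one its child, from the context. *)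
Definition placed h b :=
  (forall u, u < size h - 1 -> out L (b + u) = tout h u) /\
  (forall u, 0 < u < size h -> inn L (b + u) = tinn h u) /\
  (forall u, u < size h -> mem L (b + u) = tmem h u).

Hypothesis (Hm : 1 <= m) (Hk : 1 <= k).

Lemma size_ge h : 2 <= size h.
Proof. destruct h; simpl; unfold gsize; pose proof (base_ge 0); lia. Qed.

Ltac ifs := repeat match goal with
  | |- context [?a =? ?b] => destruct (Nat.eqb_spec a b); try lia
  | |- context [?a <? ?b] => destruct (Nat.ltb_spec a b); try lia
  | |- context [?a <=? ?b] => destruct (Nat.leb_spec a b); try lia
  end.

Lemma placed_succ h b : placed (S h) b ->
  (out L b = Fork (size h + 1) /\ out L (b + size h) = Touching (size h + 1) /\
   out L (b + 2 * size h) = Next) /\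
  (inn L (b + 1) = Spawned /\ inn L (b + size h + 1) = RightOf (size h + 1) /\
   inn L (b + 2 * size h + 1) = Join (size h + 1)) /\
  (mem L b = None /\ mem L (b + 2 * size h + 1) = None) /\
  placed h (b + 1) /\ placed h (b + size h + 1).
Proof.
  pose proof (size_ge h) as S2. intros (Ho & Hi & Hme). cbn [size] in *.
  split; [|split; [|split; [|split]]].
  - split; [|split].
    + rewrite <- (Nat.add_0_r b) at 1. rewrite Ho by lia. reflexivity.
    + rewrite Ho by lia. cbn [tout]. ifs. reflexivity.
    + rewrite Ho by lia. cbn [tout]. ifs. reflexivity.
  - rewrite <- !Nat.add_assoc. rewrite !Hi by lia. cbn [tinn]. ifs. auto.
  - split.
    + rewrite <- (Nat.add_0_r b) at 1. rewrite Hme by lia. reflexivity.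
    + rewrite <- !Nat.add_assoc. rewrite Hme by lia. cbn [tmem]. ifs. reflexivity.
  - repeat split; intros u Hu.
    + rewrite <- Nat.add_assoc, Ho by lia. cbn [tout]. ifs. f_equal. lia.
    + rewrite <- Nat.add_assoc, Hi by lia. cbn [tinn]. ifs. f_equal. lia.
    + rewrite <- Nat.add_assoc, Hme by lia. cbn [tmem]. ifs. f_equal. lia.
  - repeat split; intros u Hu.
    + rewrite <- !Nat.add_assoc, Ho by lia. cbn [tout]. ifs. f_equal. lia.
    + rewrite <- !Nat.add_assoc, Hi by lia. cbn [tinn]. ifs. f_equal. lia.
    + rewrite <- !Nat.add_assoc, Hme by lia. cbn [tmem]. ifs. f_equal. lia.
Qed.

Lemma placed_out b x : placed 0 b -> valid x -> x <> gY (m - 1) -> out L (b + pos x) = gout x.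
Proof.
  intros (Ho & _) Hx N. rewrite Ho; [cbn [tout]; now rewrite dec_pos|].
  pose proof (pos_bound x Hx). cbn [size].
  assert (pos x <> pos (gY (m - 1))).
  { intros E. apply N, pos_inj; auto. simpl; lia. }
  simpl pos in H0 at 2. unfold gsize in *. lia.
Qed.

Lemma placed_inn b x : placed 0 b -> valid x -> x <> gV 0 -> inn L (b + pos x) = ginn x.
Proof.
  intros (_ & Hi & _) Hx N. rewrite Hi; [cbn [tinn]; now rewrite dec_pos|].
  split; [|now apply pos_bound].
  assert (pos x <> pos (gV 0)).
  { intros E. apply N, pos_inj; auto. }
  simpl pos in H at 2. lia.
Qed.

Lemma placed_mem b x : placed 0 b -> valid x -> mem L (b + pos x) = gmem x.
Proof.
  intros (_ & _ & Hme) Hx. rewrite Hme; [cbn [tmem]; now rewrite dec_pos|]. now apply pos_bound.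
Qed.

Lemma out_ok_weaken lo hi lo' hi' u :
  out_ok L lo hi u -> lo' <= lo -> hi <= hi' -> out_ok L lo' hi' u.
Proof. unfold out_ok. destruct (out L u); intuition lia. Qed.

Lemma in_ok_weaken lo lo' v : in_ok L lo v -> lo' <= lo -> in_ok L lo' v.
Proof. unfold in_ok. destruct (inn L v); intuition lia. Qed.

Ltac arith_facts :=
  pose proof base_m; pose proof (base_ge 0);
  repeat match goal with
  | j : nat |- _ =>
      lazymatch goal with
      | _ : base j <= base 0 |- _ => fail
      | _ => pose proof (base_le j); pose proof (base_ge (j + 1));
             pose proof (base_le (j + 1));
             try (pose proof (base_succ j ltac:(lia)))
      end
  end.

Lemma placed_wf_grid b : placed 0 b ->
  (forall u, b <= u < b + size 0 - 1 -> out_ok L b (b + size 0 - 1) u) /\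
  (forall v, b < v < b + size 0 -> in_ok L b v).
Proof.
  intros H. assert (Hs : size 0 = base 0 + 1 + m) by reflexivity. split.
  - intros u Hu. destruct (node_cases (u - b)) as (x & Hx & E); [cbn [size] in *; lia|].
    assert (u = b + pos x) by lia. subst u. clear E.
    assert (Nx : x <> gY (m - 1)).
    { intros ->. simpl pos in Hu. lia. }
    split; [|lia]. rewrite (placed_out b x) by auto.
    assert (I : forall y w, valid y -> y <> gV 0 -> w = b + pos y -> inn L w = ginn y).
    { intros y w Hy Ny ->. now apply placed_inn. }
    destruct x as [j|[|j]|j i|j i|j i|j]; simpl in Hx;
      try (lazymatch type of Hx with _ /\ _ => destruct Hx as [Hj Hi] end);
      simpl pos in Hu |- *; cbn [gout]; arith_facts.
    + split; [lia|]. split; [lia|]. split.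
      * destruct (Nat.eq_dec (j + 1) m) as [E|E].
        -- rewrite (I (gE m)); simpl; try lia; [|discriminate]. now rewrite Nat.eqb_refl.
        -- rewrite (I (gV (j + 1))); simpl; try lia; [|intros Q; injection Q; lia].
           destruct (j + 1) eqn:Q; [lia|reflexivity].
      * rewrite (I (gF j 0)); simpl; try lia; [|discriminate]. reflexivity.
    + split; [lia|]. rewrite (I (gY 0)); simpl; try lia; [eauto|discriminate].
    + pose proof (base_succ j ltac:(lia)). replace (j + 1) with (S j) in * by lia.
      split; [lia|]. split; [lia|].
      rewrite (I (gT j 0)); simpl; replace (j + 1) with (S j) in * by lia;
        try lia; auto; discriminate.
    + split; [lia|]. split; [lia|]. split.
      * rewrite (I (gX j i)); simpl; try lia; [auto|discriminate].
      * destruct (Nat.eq_dec (i + 1) k) as [E|E].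
        -- rewrite (I (gE j)); simpl; try lia; [|discriminate].
           destruct (Nat.eqb_spec j m); [lia|reflexivity].
        -- rewrite (I (gF j (i + 1))); simpl; try lia; [|discriminate].
           destruct (i + 1) eqn:Q; [lia|reflexivity].
    + split; [lia|]. rewrite (I (gT j i)); simpl; try lia; [eauto|discriminate].
    + destruct (Nat.ltb_spec (i + 1) k).
      * split; [lia|]. split; [lia|]. rewrite (I (gT j (i + 1))); simpl; try lia; [auto|discriminate].
      * split; [lia|]. split; [lia|]. rewrite (I (gY j)); simpl; try lia; [|discriminate].
        f_equal. lia.
    + assert (HJ : j + 1 < m).
      { enough (j <> m - 1) by lia. intros ->. now apply Nx. }
      apply Nat.ltb_lt in HJ as Q. rewrite Q. split; [lia|].
      rewrite (I (gY (j + 1))); simpl; try lia; [eauto|discriminate].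
  - intros v Hv. destruct (node_cases (v - b)) as (x & Hx & E); [cbn [size] in *; lia|].
    assert (v = b + pos x) by lia. subst v. clear E.
    assert (Nx : x <> gV 0) by (intros ->; simpl pos in Hv; lia).
    unfold in_ok. rewrite (placed_inn b x) by auto.
    assert (O : forall y w, valid y -> y <> gY (m - 1) -> w = b + pos y -> out L w = gout y).
    { intros y w Hy Ny ->. now apply placed_out. }
    destruct x as [j|j|j i|j i|j i|j]; simpl in Hx;
      try (lazymatch type of Hx with _ /\ _ => destruct Hx as [Hj Hi] end);
      simpl pos in Hv |- *; cbn [ginn]; arith_facts.
    + destruct j as [|j]; [congruence|].
      rewrite (O (gV j)); simpl; try lia; [eauto|discriminate].
    + destruct (Nat.eqb_spec j m) as [->|E].
      * rewrite (O (gV (m - 1))); simpl; try lia; [eauto|discriminate].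
      * pose proof (base_succ j ltac:(lia)).
        split; [lia|]. rewrite (O (gF j (k - 1))); simpl; try lia; [auto|discriminate].
    + destruct i as [|i].
      * split; [lia|]. rewrite (O (gV j)); simpl; try lia; [auto|discriminate].
      * split; [lia|]. rewrite (O (gF j i)); simpl; try lia; [auto|discriminate].
    + rewrite (O (gF j i)); simpl; try lia; [eauto|discriminate].
    + split; [lia|]. split.
      * rewrite (O (gX j i)); simpl; try lia; [eauto|discriminate].
      * destruct i as [|i].
        -- rewrite (O (gE (j + 1))); simpl; try lia; [|discriminate].
           destruct (j + 1) eqn:Q; [lia|auto].
        -- rewrite (O (gT j i)); simpl; try lia; [|discriminate].
           destruct (Nat.ltb_spec (i + 1) k); [auto|lia].
    + split; [lia|]. split.
      * destruct j as [|j].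
        -- rewrite (O (gE 0)); simpl; try lia; [auto|discriminate].
        -- rewrite (O (gY j)); simpl; try lia; [|intros Q; injection Q; lia].
           destruct (Nat.ltb_spec (j + 1) m); [auto|lia].
      * rewrite (O (gT j (k - 1))); simpl; try lia; [|discriminate].
        destruct (Nat.ltb_spec (k - 1 + 1) k); [lia|auto].
Qed.

Lemma placed_wf h b : placed h b ->
  (forall u, b <= u < b + size h - 1 -> out_ok L b (b + size h - 1) u) /\
  (forall v, b < v < b + size h -> in_ok L b v).
Proof.
  revert b. induction h as [|h IH]; intros b H; [now apply placed_wf_grid|].
  destruct (placed_succ _ _ H) as ((O1 & O2 & O3) & (I1 & I2 & I3) & _ & P1 & P2).
  destruct (IH _ P1) as [A1 B1]. destruct (IH _ P2) as [A2 B2].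
  pose proof (size_ge h) as S2. cbn [size]. set (n := size h) in *. split.
  - intros u Hu.
    destruct (Nat.eq_dec u b) as [->|N1].
    { unfold out_ok. rewrite O1. replace (b + (n + 1)) with (b + n + 1) by lia.
      repeat split; auto; lia. }
    destruct (lt_dec u (b + n)); [eapply out_ok_weaken; [apply A1; lia|lia|lia]|].
    destruct (Nat.eq_dec u (b + n)) as [->|N2].
    { unfold out_ok. rewrite O2. replace (b + n + (n + 1)) with (b + 2 * n + 1) by lia.
      repeat split; auto; lia. }
    destruct (lt_dec u (b + 2 * n)); [eapply out_ok_weaken; [apply A2; lia|lia|lia]|].
    assert (u = b + 2 * n) as -> by lia.
    unfold out_ok. rewrite O3. repeat split; eauto; lia.
  - intros v Hv.
    destruct (Nat.eq_dec v (b + 1)) as [->|N1].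
    { unfold in_ok. rewrite I1. replace (b + 1 - 1) with b by lia. eauto. }
    destruct (lt_dec v (b + n + 1)); [eapply in_ok_weaken; [apply B1; lia|lia]|].
    destruct (Nat.eq_dec v (b + n + 1)) as [->|N2].
    { unfold in_ok. rewrite I2. replace (b + n + 1 - (n + 1)) with b by lia. split; auto. lia. }
    destruct (lt_dec v (b + 2 * n + 1)); [eapply in_ok_weaken; [apply B2; lia|lia]|].
    assert (v = b + 2 * n + 1) as -> by lia.
    unfold in_ok. rewrite I3. replace (b + 2 * n + 1 - 1) with (b + 2 * n) by lia.
    replace (b + 2 * n + 1 - (n + 1)) with (b + n) by lia. repeat split; auto; lia.
Qed.

(** * Threads, touches and depth in grids and trees *)

Variables (N : nat) (W : wf N L).
Let G := comp_of N L.

Lemma cedge_next u v : u < N -> out L u = Next -> v = u + 1 -> cedge G u v.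
Proof. intros H E ->. apply (edge_out N L). rewrite E. simpl. auto. Qed.

Lemma cedge_right u v r : u < N -> out L u = Fork r -> v = u + r -> cedge G u v.
Proof. intros H E ->. apply (edge_out N L). rewrite E. simpl. auto. Qed.

Lemma step_spawn u v r : u < N -> out L u = Fork r -> v = u + 1 -> step G u v.
Proof. intros H E ->. exists Fut. apply (edge_out N L). rewrite E. simpl. auto. Qed.

Lemma step_touch u v d : u < N -> out L u = Touching d -> v = u + d -> step G u v.
Proof. intros H E ->. exists Touch. apply (edge_out N L). rewrite E. simpl. auto. Qed.

Ltac pout := rewrite placed_out; simpl; auto; try lia; try discriminate;
  try (let Q := fresh in intros Q; injection Q; lia).

Lemma T_lt_Y j : j < m -> pos (gT j (k - 1)) + 2 <= pos (gY j).
Proof. intros Hj. simpl. pose proof (base_succ j Hj). pose proof (base_le j). lia. Qed.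

Section PlacedGrid.
Variables (b : nat) (Hb : placed 0 b) (Hn : b + gsize <= N).

Lemma grid_lt x : valid x -> b + pos x < N.
Proof. intros H. pose proof (pos_bound x H). lia. Qed.

Lemma cedge_F j i : j < m -> i + 1 < k -> cedge G (b + pos (gF j i)) (b + pos (gF j (i + 1))).
Proof.
  intros Hj Hi. eapply cedge_right; [apply grid_lt; simpl; lia| |].
  - pout.
  - simpl. lia.
Qed.

Lemma creach_F j i i' : j < m -> i <= i' < k -> creach G (b + pos (gF j i)) (b + pos (gF j i')).
Proof.
  intros Hj Hi. replace i' with (i + (i' - i)) by lia.
  assert (Q : i + (i' - i) < k) by lia. revert Q.
  induction (i' - i) as [|e IH]; intros Q.
  - rewrite Nat.add_0_r. apply rt_refl.
  - eapply rt_trans; [apply IH; lia|]. apply rt_step.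
    replace (i + S e) with (i + e + 1) by lia. apply cedge_F; lia.
Qed.

Lemma creach_F_E j i : j < m -> i < k -> creach G (b + pos (gF j i)) (b + pos (gE j)).
Proof.
  intros Hj Hi. eapply rt_trans; [apply (creach_F j i (k - 1)); lia|]. apply rt_step.
  eapply cedge_right; [apply grid_lt; simpl; lia| |].
  - pout.
  - simpl. pose proof (base_succ j Hj). lia.
Qed.

Lemma creach_V_E j : j < m -> creach G (b + pos (gV j)) (b + pos (gE j)).
Proof.
  intros Hj. eapply rt_trans; [|apply (creach_F_E j 0); lia]. apply rt_step.
  eapply cedge_right; [apply grid_lt; simpl; lia| |].
  - pout.
  - simpl. pose proof (base_ge (j + 1)). lia.
Qed.

Lemma creach_Y j : j < m -> creach G (b + pos (gE 0)) (b + pos (gY j)).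
Proof.
  induction j as [|j IH]; intros Hj.
  - apply rt_step. eapply cedge_next; [apply grid_lt; simpl; lia| |].
    + pout.
    + simpl. lia.
  - eapply rt_trans; [apply IH; lia|]. apply rt_step.
    eapply cedge_next; [apply grid_lt; simpl; lia| |].
    + pout.
      destruct (Nat.ltb_spec (j + 1) m); [auto|lia].
    + simpl. lia.
Qed.

Lemma out_T j i : j < m -> i + 1 < k -> out L (b + pos (gT j i)) = Touching 3.
Proof.
  intros Hj Hi. pout.
  destruct (Nat.ltb_spec (i + 1) k); [auto|lia].
Qed.

Lemma out_T_last j : j < m -> out L (b + pos (gT j (k - 1))) =
  Touching (pos (gY j) - pos (gT j (k - 1))).
Proof.
  intros Hj. pout.
  destruct (Nat.ltb_spec (k - 1 + 1) k); [lia|auto].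
Qed.

Lemma reach_T j i : j < m -> i < k -> reach G (b + pos (gT j 0)) (b + pos (gT j i)).
Proof.
  intros Hj. induction i as [|i IH]; intros Hi; [apply rt_refl|].
  eapply rt_trans; [apply IH; lia|]. apply rt_step.
  eapply step_touch; [apply grid_lt; simpl; lia|apply out_T; lia|]. simpl. lia.
Qed.

(** For the last column of row [j + 1]: its thread touches [gY (j + 1)], whose local parent [gY j]
    has to be a descendant of the right child [gE (j + 1)] of the fork. The chain of touches in row
    [j] provides the path. *)
Lemma reach_E_Y j : j < m -> reach G (b + pos (gE (j + 1))) (b + pos (gY j)).
Proof.
  intros Hj. eapply rt_trans; [|eapply rt_trans; [apply (reach_T j (k - 1)); lia|]].
  - apply rt_step. eapply step_touch; [apply grid_lt; simpl; lia| |].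
    + pout.
      destruct (j + 1) eqn:Q; [lia|reflexivity].
    + simpl. lia.
  - apply rt_step. pose proof (T_lt_Y j Hj).
    eapply step_touch; [apply grid_lt; simpl; lia|apply out_T_last; lia|]. lia.
Qed.

Lemma grid_forks u r : b <= u < b + gsize - 1 -> out L u = Fork r ->
  exists l d, creach G (u + 1) l /\ out L l = Touching d /\ reach G (u + r) (l + d - 1).
Proof.
  intros Hu E. destruct (node_cases (u - b)) as (x & Hx & Q); [lia|].
  assert (u = b + pos x) by lia. subst u. clear Q.
  rewrite (placed_out b x) in E; auto.
  2:{ intros ->. unfold gsize in Hu. simpl in Hu. lia. }
  assert (XT : forall j i, j < m -> i < k ->
     creach G (b + pos (gF j i) + 1) (b + pos (gT j i))).
  { intros j i Hj Hi. replace (b + pos (gF j i) + 1) with (b + pos (gX j i)) by (simpl; lia).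
    apply rt_step. eapply cedge_next; [apply grid_lt; simpl; lia| |].
    - pout.
    - simpl. lia. }
  assert (FX : forall j i, j < m -> i < k ->
     reach G (b + pos (gF j i)) (b + pos (gX j i))).
  { intros j i Hj Hi. apply rt_step. eapply step_spawn; [apply grid_lt; simpl; lia| |].
    - pout.
    - simpl. lia. }
  destruct x as [j|[|j]|j i|j i|j i|j]; simpl in E; try discriminate.
  - injection E as <-. simpl in Hx. exists (b + pos (gE (j + 1))), 3.
    pose proof (base_ge (j + 1)). split; [|split].
    + destruct (Nat.eq_dec (j + 1) m) as [Q|Q].
      * replace (b + pos (gV j) + 1) with (b + pos (gE (j + 1))); [apply rt_refl|].
        rewrite Q. simpl. rewrite base_m. lia.
      * replace (b + pos (gV j) + 1) with (b + pos (gV (j + 1))) by (simpl; lia).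
        apply creach_V_E; lia.
    + pout.
      destruct (j + 1) eqn:Q; [lia|reflexivity].
    + replace (b + pos (gV j) + (base (j + 1) + 1 - j)) with (b + pos (gF j 0)) by (simpl; lia).
      replace (b + pos (gE (j + 1)) + 3 - 1) with (b + pos (gX j 0)) by (simpl; lia).
      apply FX; lia.
  - injection E as <-. simpl in Hx. destruct Hx as [Hj Hi].
    destruct (Nat.eq_dec (i + 1) k) as [Q|Q].
    + assert (i = k - 1) by lia. subst i.
      exists (b + pos (gT j (k - 1))), (pos (gY j) - pos (gT j (k - 1))).
      pose proof (T_lt_Y j Hj). split; [|split].
      * apply XT; lia.
      * apply out_T_last; auto.
      * replace (b + pos (gF j (k - 1)) + 3) with (b + pos (gE j))
          by (simpl; pose proof (base_succ j Hj); lia).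
        destruct j as [|j].
        -- replace (b + pos (gT 0 (k - 1)) + _ - 1) with (b + pos (gE 0)) by (simpl in *; lia).
           apply rt_refl.
        -- replace (b + pos (gT (S j) (k - 1)) + _ - 1) with (b + pos (gY j)) by (simpl in *; lia).
           replace (S j) with (j + 1) by lia. apply reach_E_Y. lia.
    + exists (b + pos (gT j i)), 3. split; [|split].
      * apply XT; lia.
      * apply out_T; lia.
      * replace (b + pos (gF j i) + 3) with (b + pos (gF j (i + 1))) by (simpl; lia).
        replace (b + pos (gT j i) + 3 - 1) with (b + pos (gX j (i + 1))) by (simpl; lia).
        apply FX; lia.
  - destruct (i + 1 <? k) in E; discriminate.
  - destruct (j + 1 <? m) in E; discriminate.
Qed.

(** The reason for the linear span: the touches of row [j] wait for [gE (j + 1)], which waits only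
    for forks and for no touch of its own row. Hence all rows can share levels, and [j] enters only
    along the spine and the [gY] chain. *)
Definition depth x :=
  match x with
  | gV j => j
  | gF _ i => m + i
  | gX _ _ => m + k
  | gE _ => m + k + 1
  | gT _ i => m + k + 2 + i
  | gY j => m + 2 * k + 2 + j
  end.

Lemma depth_step x u v : valid x -> u = b + pos x -> b <= u < b + gsize - 1 -> step G u v ->
  exists y, valid y /\ v = b + pos y /\ depth x < depth y.
Proof.
  intros Hx -> Hu Hs. apply (step_out N L) in Hs; [|now apply grid_lt].
  assert (Nx : x <> gY (m - 1)) by (intros ->; unfold gsize in Hu; simpl in Hu; lia).
  rewrite (placed_out b x) in Hs by auto.
  destruct x as [j|[|j]|j i|j i|j i|j]; simpl in Hx;
    try (lazymatch type of Hx with _ /\ _ => destruct Hx as [Hj Hi] end);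
    simpl in Hs; arith_facts.
  - destruct Hs as [->| ->].
    + destruct (Nat.eq_dec (j + 1) m) as [E|E].
      * exists (gE m). simpl. lia.
      * exists (gV (j + 1)). simpl. lia.
    + exists (gF j 0). simpl. lia.
  - exists (gY 0). simpl. lia.
  - exists (gT j 0). simpl. replace (j + 1) with (S j) by lia. lia.
  - destruct Hs as [->| ->].
    + exists (gX j i). simpl. lia.
    + destruct (Nat.eq_dec (i + 1) k) as [E|E].
      * exists (gE j). simpl. lia.
      * exists (gF j (i + 1)). simpl. lia.
  - exists (gT j i). simpl. lia.
  - destruct (Nat.ltb_spec (i + 1) k).
    + exists (gT j (i + 1)). simpl. lia.
    + exists (gY j). simpl. lia.
  - destruct (Nat.ltb_spec (j + 1) m).
    + exists (gY (j + 1)). simpl. lia.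
    + destruct Hs.
Qed.

Lemma grid_path e i : S (i + e) <= k ->
  is_path G (map (fun i => b + pos (gF 0 i)) (seq i (S e))).
Proof.
  revert i. induction e as [|e IH]; intros i Hi; [exact I|].
  specialize (IH (S i) ltac:(lia)). cbn [seq map] in *. split; [|exact IH].
  exists Cont. replace (S i) with (i + 1) by lia. apply cedge_F; lia.
Qed.
End PlacedGrid.

Lemma placed_main h b : placed h b -> b + size h <= N -> creach G b (b + size h - 1).
Proof.
  revert b. induction h as [|h IH]; intros b H Hn.
  - cbn [size] in *. pose proof (creach_V_E b H Hn 0 ltac:(lia)) as A.
    pose proof (creach_Y b H Hn (m - 1) ltac:(lia)) as B.
    replace (b + gsize - 1) with (b + pos (gY (m - 1))) by (unfold gsize; simpl; lia).
    replace b with (b + pos (gV 0)) at 1 by (simpl; lia). eapply rt_trans; eauto.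
  - destruct (placed_succ _ _ H) as ((O1 & O2 & O3) & (I1 & I2 & I3) & _ & P1 & P2).
    pose proof (size_ge h) as S2. cbn [size] in *. set (n := size h) in *.
    eapply rt_trans; [|eapply rt_trans; [apply (IH _ P2); lia|]]; apply rt_step.
    + eapply cedge_right; eauto; lia.
    + eapply cedge_next; [| |]; replace (b + n + 1 + n - 1) with (b + 2 * n) by lia; auto; lia.
Qed.

Lemma placed_forks h b u r : placed h b -> b + size h <= N -> b <= u < b + size h - 1 ->
  out L u = Fork r ->
  exists l d, creach G (u + 1) l /\ out L l = Touching d /\ reach G (u + r) (l + d - 1).
Proof.
  revert b. induction h as [|h IH]; intros b H Hn Hu E; [eapply grid_forks; eauto|].
  destruct (placed_succ _ _ H) as ((O1 & O2 & O3) & _ & _ & P1 & P2).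
  pose proof (size_ge h) as S2. cbn [size] in *. set (n := size h) in *.
  destruct (Nat.eq_dec u b) as [->|N1].
  { rewrite O1 in E. injection E as <-. exists (b + n), (n + 1). split; [|split]; auto.
    - replace (b + n) with (b + 1 + n - 1) by lia. apply placed_main; auto. fold n. lia.
    - apply (creach_reach N L).
      replace (b + (n + 1)) with (b + n + 1) by lia.
      replace (b + n + (n + 1) - 1) with (b + n + 1 + n - 1) by lia.
      apply placed_main; auto. fold n. lia. }
  destruct (lt_dec u (b + n)); [apply (IH _ P1); auto; lia|].
  destruct (Nat.eq_dec u (b + n)) as [->|N2]; [congruence|].
  destruct (lt_dec u (b + 2 * n)); [apply (IH _ P2); auto; lia|].
  assert (u = b + 2 * n) as -> by lia. congruence.
Qed.

(** The two subtrees share their levels, so a level of the tree adds only 2, one for the fork and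
    one for the join. *)
Lemma placed_depth h b : placed h b -> b + size h <= N ->
  exists dep, (forall u v, b <= u < b + size h - 1 -> step G u v -> dep u < dep v) /\
    (forall v, b <= v < b + size h -> dep v <= 2 * m + 2 * k + 2 + 2 * h).
Proof.
  revert b. induction h as [|h IH]; intros b H Hn.
  - cbn [size] in *. exists (fun u => depth (dec (u - b))). split.
    + intros u v Hu Hs. destruct (node_cases (u - b)) as (x & Hx & E); [lia|].
      destruct (depth_step b H Hn x u v Hx ltac:(lia) Hu Hs) as (y & Hy & -> & Hd).
      rewrite E, dec_pos by auto. replace (b + pos y - b) with (pos y) by lia.
      now rewrite dec_pos.
    + intros v Hv. destruct (node_cases (v - b)) as (x & Hx & E); [lia|].
      rewrite E, dec_pos by auto. destruct x; simpl in Hx |- *; lia.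
  - destruct (placed_succ _ _ H) as ((O1 & O2 & O3) & _ & _ & P1 & P2).
    pose proof (size_ge h) as S2.
    destruct (placed_wf _ _ P1) as [A1 _]. destruct (placed_wf _ _ P2) as [A2 _].
    cbn [size] in *. set (n := size h) in *.
    destruct (IH _ P1 ltac:(lia)) as (d1 & D1 & B1).
    destruct (IH _ P2 ltac:(lia)) as (d2 & D2 & B2).
    exists (fun u => if u =? b then 0 else if u <? b + n + 1 then S (d1 u)
      else if u <? b + 2 * n + 1 then S (d2 u) else 2 * m + 2 * k + 2 + 2 * h + 2).
    split; [|intros v Hv; ifs; [specialize (B1 v)|specialize (B2 v)]; lia].
    intros u v Hu Hs. pose proof Hs as Hst. apply (step_out N L) in Hs; [|lia].
    destruct (Nat.eqb_spec u b) as [->|N1].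
    { rewrite O1 in Hs. destruct Hs as [->| ->]; ifs. }
    assert (In1 : forall lo hi, out_ok L lo hi u ->
      match out L u with
      | Fork r => v = u + 1 \/ v = u + r
      | Next => v = u + 1
      | Touching d => v = u + d
      | Stop => False end -> u < v <= hi).
    { intros lo hi [Q _]. destruct (out L u); lia. }
    destruct (Nat.ltb_spec u (b + n + 1)).
    + destruct (Nat.eq_dec u (b + n)) as [->|N2].
      * rewrite O2 in Hs. subst v. specialize (B1 (b + n)). ifs.
      * specialize (In1 _ _ (A1 u ltac:(lia)) Hs). specialize (D1 u v ltac:(lia) Hst).
        ifs.
    + destruct (Nat.eq_dec u (b + 2 * n)) as [->|N2].
      * rewrite O3 in Hs. subst v. specialize (B2 (b + 2 * n)). ifs.
      * specialize (In1 _ _ (A2 u ltac:(lia)) Hs). specialize (D2 u v ltac:(lia) Hst).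
        ifs.
Qed.

Lemma placed_path h b : placed h b -> b + size h <= N -> exists l, is_path G l /\ length l = k.
Proof.
  revert b. induction h as [|h IH]; intros b H Hn.
  - exists (map (fun i => b + pos (gF 0 i)) (seq 0 k)).
    rewrite length_map, length_seq. split; auto.
    replace k with (S (k - 1)) by lia. apply grid_path; auto. lia.
  - destruct (placed_succ _ _ H) as (_ & _ & _ & P1 & _). cbn [size] in Hn.
    apply (IH _ P1). lia.
Qed.

(** * The sequential execution *)

(** As nodes are numbered in execution order, the next node and the deque determine the whole state
    of a sequential run. *)
Definition sst t D := mkS (upd (fun _ => None) 0 (Some t)) (upd (fun _ => []) 0 D) (rev (seq 0 t)).

Definition seqrun t D t' D' :=
  t <= t' /\ ws_run G 1 (sst t D) (map (pair 0) (seq t (t' - t))) (sst t' D').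

Lemma seqrun_refl t D : seqrun t D t D.
Proof. split; auto. rewrite Nat.sub_diag. constructor. Qed.

Lemma seqrun_trans t1 D1 t2 D2 t3 D3 :
  seqrun t1 D1 t2 D2 -> seqrun t2 D2 t3 D3 -> seqrun t1 D1 t3 D3.
Proof.
  intros [A1 B1] [A2 B2]. split; [lia|].
  replace (t3 - t1) with ((t2 - t1) + (t3 - t2)) by lia.
  rewrite seq_app, map_app. replace (t1 + (t2 - t1)) with t2 by lia. eapply run_app; eauto.
Qed.

Lemma seq_snoc t : seq 0 (t + 1) = seq 0 t ++ [t].
Proof. now rewrite seq_app. Qed.

Lemma seq_ready t : t < N -> ready G (rev (seq 0 t)) t.
Proof.
  intros Ht u Hu. apply (step_lt N L W) in Hu. rewrite <- in_rev, in_seq. lia.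
Qed.

Lemma seq_fresh t : ~ In t (rev (seq 0 t)).
Proof. rewrite <- in_rev, in_seq. lia. Qed.

Lemma sst_succ c t : mkS (upd (fun _ => None) 0 (Some (t + 1))) c (t :: rev (seq 0 t)) =
  mkS (upd (fun _ => None) 0 (Some (t + 1))) c (rev (seq 0 (t + 1))).
Proof. now rewrite seq_snoc, rev_app_distr. Qed.

Lemma seqrun_fork t D r : t < N -> out L t = Fork r -> seqrun t D (t + 1) ((t + r) :: D).
Proof.
  intros Ht E. split; [lia|]. replace (t + 1 - t) with 1 by lia. apply run_one.
  pose proof (exec_fork N L 1 (upd (fun _ => None) 0 (Some t)) (upd (fun _ => []) 0 D)
    (rev (seq 0 t)) 0 t r ltac:(lia) (upd_eq _ _ _) Ht (seq_fresh t) (seq_ready t Ht) E) as S.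
  rewrite !upd_upd, upd_eq, sst_succ in S. exact S.
Qed.

Lemma seqrun_next t D : t < N -> out L t = Next -> seqrun t D (t + 1) D.
Proof.
  intros Ht E. split; [lia|]. replace (t + 1 - t) with 1 by lia. apply run_one.
  pose proof (out_cases N L W t Ht) as O. rewrite E in O. destruct O as [O1 [d O2]].
  pose proof (in_cases N L W (t + 1) ltac:(lia)) as I. rewrite O2 in I.
  pose proof (exec_next N L W 1 (upd (fun _ => None) 0 (Some t)) (upd (fun _ => []) 0 D)
    (rev (seq 0 t)) 0 t d ltac:(lia) (upd_eq _ _ _) Ht (seq_fresh t) (seq_ready t Ht) E O2) as S.
  rewrite !upd_upd, sst_succ in S. apply S. rewrite <- in_rev, in_seq. lia.
Qed.

(** The touch [t + d] has the local parent [t + d - 1], which is at least [t + 1] and hence not yet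
    executed. The processor therefore pops its deque. *)
Lemma seqrun_touch t D d : t < N -> out L t = Touching d -> seqrun t ((t + 1) :: D) (t + 1) D.
Proof.
  intros Ht E. split; [lia|]. replace (t + 1 - t) with 1 by lia.
  pose proof (out_cases N L W t Ht) as O. rewrite E in O.
  pose proof (exec_touch_wait N L W 1 (upd (fun _ => None) 0 (Some t))
    (upd (fun _ => []) 0 ((t + 1) :: D))
    (rev (seq 0 t)) 0 t d ltac:(lia) (upd_eq _ _ _) Ht (seq_fresh t) (seq_ready t Ht) E) as S.
  eapply run_exec; [apply S; rewrite <- in_rev, in_seq; lia|].
  apply run_idle. rewrite upd_upd.
  pose proof (st_pop G 1 (mkS (upd (fun _ => None) 0 None) (upd (fun _ => []) 0 ((t + 1) :: D))
    (t :: rev (seq 0 t))) 0 (t + 1) D ltac:(lia) (upd_eq _ _ _) (upd_eq _ _ _)) as S2.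
  cbn [cur dq done] in S2. rewrite !upd_upd, sst_succ in S2. exact S2.
Qed.

Section GridSeq.
Variables (b : nat) (Hb : placed 0 b) (Hn : b + gsize <= N).

Lemma seqrun_column j i D : j < m -> i < k ->
  seqrun (b + pos (gF j i)) D (b + pos (gF j i) + 3) D.
Proof.
  intros Hj Hi.
  assert (LT : forall x, valid x -> b + pos x < N) by (intros; now apply grid_lt).
  eapply seqrun_trans; [apply (seqrun_fork _ _ 3); [apply LT; simpl; lia|pout]|].
  replace (b + pos (gF j i) + 1) with (b + pos (gX j i)) by (simpl; lia).
  eapply seqrun_trans; [apply seqrun_next; [apply LT; simpl; lia|pout]|].
  replace (b + pos (gX j i) + 1) with (b + pos (gT j i)) by (simpl; lia).
  replace (b + pos (gF j i) + 3) with (b + pos (gT j i) + 1) by (simpl; lia).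
  destruct (Nat.eq_dec (i + 1) k).
  - replace i with (k - 1) by lia. eapply seqrun_touch; [apply LT; simpl; lia|].
    now apply out_T_last.
  - eapply seqrun_touch; [apply LT; simpl; lia|]. now apply out_T; try lia.
Qed.

Lemma seqrun_columns j i D : j < m -> i <= k ->
  seqrun (b + pos (gF j 0)) D (b + pos (gF j 0) + 3 * i) D.
Proof.
  intros Hj. induction i as [|i IH]; intros Hi.
  - rewrite Nat.add_0_r. apply seqrun_refl.
  - eapply seqrun_trans; [apply IH; lia|].
    replace (b + pos (gF j 0) + 3 * i) with (b + pos (gF j i)) by (simpl; lia).
    replace (b + pos (gF j 0) + 3 * S i) with (b + pos (gF j i) + 3) by (simpl; lia).
    apply seqrun_column; lia.
Qed.

Definition rows j := map (fun j => b + pos (gF j 0)) (seq 0 j).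

Lemma rows_succ j : rev (rows (j + 1)) = (b + pos (gF j 0)) :: rev (rows j).
Proof. unfold rows. rewrite seq_snoc, map_app, rev_app_distr. reflexivity. Qed.

Lemma seqrun_spine j D : j <= m ->
  seqrun b D (b + j) (rev (rows j) ++ D).
Proof.
  induction j as [|j IH]; intros Hj.
  - rewrite Nat.add_0_r. apply seqrun_refl.
  - eapply seqrun_trans; [apply IH; lia|]. replace (S j) with (j + 1) by lia.
    rewrite rows_succ, Nat.add_assoc. cbn [app].
    replace (b + pos (gF j 0)) with (b + j + (base (j + 1) + 1 - j))
      by (simpl; pose proof (base_ge (j + 1)); lia).
    apply seqrun_fork; [apply (grid_lt b Hn (gV j)); simpl; lia|].
    change (b + j) with (b + pos (gV j)). pout.
Qed.

Lemma seqrun_rows j D : j <= m ->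
  seqrun (b + base m) (rev (rows m) ++ D) (b + base (m - j)) (rev (rows (m - j)) ++ D).
Proof.
  induction j as [|j IH]; intros Hj.
  - rewrite Nat.sub_0_r. apply seqrun_refl.
  - eapply seqrun_trans; [apply IH; lia|].
    set (i := m - S j). replace (m - j) with (i + 1) by lia.
    rewrite rows_succ. cbn [app].
    replace (b + base (i + 1)) with (b + pos (gE (i + 1))) by reflexivity.
    replace (b + pos (gF i 0)) with (b + pos (gE (i + 1)) + 1) by (simpl; lia).
    eapply seqrun_trans.
    (* [gT i 0] still lacks its local parent, so the processor pops row [i], the innermost one left
       in the deque, whose first node is numbered directly after [gE (i + 1)]. *)
    + apply (seqrun_touch _ _ 3); [apply (grid_lt b Hn); simpl; lia|].
      rewrite placed_out; auto; [|simpl; lia|discriminate].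
      destruct (i + 1) eqn:Q; [lia|reflexivity].
    + replace (b + pos (gE (i + 1)) + 1) with (b + pos (gF i 0)) by (simpl; lia).
      replace (b + base i) with (b + pos (gF i 0) + 3 * k)
        by (simpl; pose proof (base_succ i ltac:(lia)); lia).
      apply seqrun_columns; lia.
Qed.

Lemma seqrun_tail j D : j < m -> seqrun (b + base 0) D (b + pos (gY j)) D.
Proof.
  induction j as [|j IH]; intros Hj.
  - replace (b + pos (gY 0)) with (b + pos (gE 0) + 1) by (simpl; lia).
    apply seqrun_next; [apply (grid_lt b Hn (gE 0)); simpl; lia|].
    change (b + base 0) with (b + pos (gE 0)). pout.
  - eapply seqrun_trans; [apply IH; lia|].
    replace (b + pos (gY (S j))) with (b + pos (gY j) + 1) by (simpl; lia).
    apply seqrun_next; [apply (grid_lt b Hn (gY j)); simpl; lia|].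
    pout. destruct (Nat.ltb_spec (j + 1) m); [auto|lia].
Qed.

Lemma seqrun_grid D : seqrun b D (b + gsize - 1) D.
Proof.
  eapply seqrun_trans; [apply (seqrun_spine m); auto|]. rewrite <- base_m at 1.
  eapply seqrun_trans; [apply (seqrun_rows m); auto|]. rewrite Nat.sub_diag. simpl rev. cbn [app].
  replace (b + gsize - 1) with (b + pos (gY (m - 1))) by (unfold gsize; simpl; lia).
  apply seqrun_tail. lia.
Qed.

Definition acc (o : option nat) := match o with Some x => [x] | None => [] end.

Lemma accesses_columns j i : j < m -> i <= k ->
  accesses (mem L) (seq (b + pos (gF j 0)) (3 * i)) =
  flat_map (fun i => acc (gmem (gX j i)) ++ acc (gmem (gT j i))) (seq 0 i).
Proof.
  intros Hj. induction i as [|i IH]; intros Hi; auto.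
  replace (3 * S i) with (3 * i + 3) by lia.
  rewrite seq_app, accesses_app, IH by lia.
  replace (S i) with (i + 1) by lia. rewrite seq_snoc, flat_map_app. f_equal.
  assert (M : forall x v, valid x -> v = b + pos x -> mem L v = gmem x).
  { intros x v Hx ->. now apply placed_mem. }
  unfold accesses. cbn [flat_map seq].
  rewrite (M (gF j i)), (M (gX j i)), (M (gT j i)); simpl pos; try (simpl; lia).
  change (gmem (gF j i)) with (@None nat). unfold acc. rewrite !app_nil_r. reflexivity.
Qed.

Lemma accesses_none l : (forall v, In v l -> mem L v = None) -> accesses (mem L) l = [].
Proof.
  induction l as [|v l IH]; intros H; auto. unfold accesses in *. simpl.
  rewrite H by now left. apply IH. intros; apply H; now right.
Qed.
End GridSeq.

Lemma seqrun_placed h b D : placed h b -> b + size h <= N -> seqrun b D (b + size h - 1) D.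
Proof.
  revert b D. induction h as [|h IH]; intros b D H Hn; [now apply seqrun_grid|].
  destruct (placed_succ _ _ H) as ((O1 & O2 & O3) & _ & _ & P1 & P2).
  pose proof (size_ge h) as S2. cbn [size] in *. set (n := size h) in *.
  eapply seqrun_trans; [apply seqrun_fork; eauto; lia|].
  eapply seqrun_trans; [apply (IH _ _ P1); lia|]. fold n.
  replace (b + 1 + n - 1) with (b + n) by lia.
  replace (b + (n + 1)) with (b + n + 1) by lia.
  eapply seqrun_trans; [eapply seqrun_touch; eauto; lia|].
  eapply seqrun_trans; [apply (IH _ _ P2); lia|]. fold n.
  replace (b + n + 1 + n - 1) with (b + 2 * n) by lia.
  replace (b + (2 * n + 2) - 1) with (b + 2 * n + 1) by lia.
  apply seqrun_next; auto; lia.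
Qed.

(** * Access sequences of rows, grids and trees *)

Lemma rev_seq_map n : rev (seq 0 n) = map (fun r => n - 1 - r) (seq 0 n).
Proof.
  induction n as [|n IH]; auto. replace (S n) with (n + 1) at 1 by lia.
  rewrite seq_snoc, rev_app_distr, IH. cbn [rev app seq map]. f_equal; [lia|].
  rewrite <- seq_shift, map_map. apply map_ext. intros; lia.
Qed.

Lemma flat_map_periodic (f : nat -> list nat) p q : (forall i, f (i + p) = f i) ->
  flat_map f (seq 0 (p * q)) = concat (repeat (flat_map f (seq 0 p)) q).
Proof.
  intros H.
  assert (Sh : forall l a, flat_map f (seq (a + p) l) = flat_map f (seq a l)).
  { induction l as [|l IHl]; intros a; auto. cbn [seq flat_map]. rewrite H. f_equal.
    apply (IHl (S a)). }
  induction q as [|q IH]; [now rewrite Nat.mul_0_r|].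
  replace (p * S q) with (p + p * q) by lia.
  rewrite seq_app, flat_map_app. cbn [repeat concat]. f_equal. rewrite <- IH. apply Sh.
Qed.

Lemma gmem_period j i : gmem (gX j (i + 2 * (C + 1))) = gmem (gX j i) /\
  gmem (gT j (i + 2 * (C + 1))) = gmem (gT j i).
Proof.
  cbn [gmem]. replace (i + 2 * (C + 1)) with (i + 1 * (2 * (C + 1))) by lia.
  now rewrite Nat.Div0.mod_add.
Qed.


Lemma flat_map_singleton {A} (f : nat -> list A) (g : nat -> A) l :
  (forall i, In i l -> f i = [g i]) -> flat_map f l = map g l.
Proof.
  induction l as [|x l IH]; intros H; auto. simpl. rewrite H by now left. simpl. f_equal.
  apply IH. intros; apply H; now right.
Qed.

Lemma flat_map_nil {A} (f : nat -> list A) l : (forall i, In i l -> f i = []) -> flat_map f l = [].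
Proof.
  induction l as [|x l IH]; intros H; auto. simpl. rewrite H by now left. simpl.
  apply IH. intros; apply H; now right.
Qed.

Lemma acc_first j i : In i (seq 0 (C + 1)) ->
  acc (gmem (gX j i)) = [C + 1 - 1 - i] /\ acc (gmem (gT j i)) = [].
Proof.
  intros H. apply in_seq in H. cbn [gmem]. rewrite Nat.mod_small by lia. ifs.
  split; auto. cbn [acc]. f_equal. lia.
Qed.

Lemma acc_second j i : In i (seq (C + 1) (C + 1)) ->
  acc (gmem (gX j i)) = [] /\ acc (gmem (gT j i)) = [i - (C + 1)].
Proof.
  intros H. apply in_seq in H. cbn [gmem]. rewrite Nat.mod_small by lia. ifs.
  split; auto. cbn [acc]. f_equal. lia.
Qed.

Lemma map_sub_seq n : map (fun i => i - n) (seq n n) = seq 0 n.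
Proof.
  assert (K : forall l a, map (fun i => i - n) (seq (n + a) l) = seq a l).
  { induction l as [|l IH]; intros a; auto. cbn [seq map]. f_equal; [lia|].
    rewrite plus_n_Sm. apply IH. }
  specialize (K n 0). now rewrite Nat.add_0_r in K.
Qed.

(** In the first half of each period the [gX] nodes access [C, ..., 0], in the second half nothing.
    With the ascending accesses of the [gT] nodes taken out, only descending sweeps remain. *)
Lemma acc_X j q : flat_map (fun i => acc (gmem (gX j i))) (seq 0 (2 * (C + 1) * q)) =
  concat (repeat (rev (seq 0 (C + 1))) q).
Proof.
  rewrite (flat_map_periodic _ (2 * (C + 1)) q).
  - f_equal. f_equal. replace (2 * (C + 1)) with ((C + 1) + (C + 1)) by lia.
    rewrite seq_app, flat_map_app. rewrite (flat_map_nil _ (seq (0 + (C + 1)) (C + 1))).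
    + rewrite app_nil_r, rev_seq_map. apply flat_map_singleton.
      intros i Hi. now apply acc_first.
    + intros i Hi. now apply acc_second.
  - intros i. now rewrite (proj1 (gmem_period j i)).
Qed.

Lemma acc_T j q : flat_map (fun i => acc (gmem (gT j i))) (seq 0 (2 * (C + 1) * q)) =
  concat (repeat (seq 0 (C + 1)) q).
Proof.
  rewrite (flat_map_periodic _ (2 * (C + 1)) q).
  - f_equal. f_equal. replace (2 * (C + 1)) with ((C + 1) + (C + 1)) by lia.
    rewrite seq_app, flat_map_app. rewrite (flat_map_nil _ (seq 0 (C + 1))).
    + cbn [app]. rewrite <- (map_sub_seq (C + 1)). apply flat_map_singleton.
      intros i Hi. now apply acc_second.
    + intros i Hi. now apply acc_first.
  - intros i. now rewrite (proj2 (gmem_period j i)).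
Qed.

Lemma sweep_seq : sweep C (seq 0 (C + 1)).
Proof. split; [apply seq_NoDup|rewrite length_seq; lia]. Qed.

(** Written as a sweep followed by its reversal, the form to which [sweeps_le] applies. *)
Definition round := rev (seq 0 (C + 1)) ++ rev (rev (seq 0 (C + 1))).

Lemma acc_XT j q :
  flat_map (fun i => acc (gmem (gX j i)) ++ acc (gmem (gT j i))) (seq 0 (2 * (C + 1) * q)) =
  concat (repeat round q).
Proof.
  rewrite (flat_map_periodic _ (2 * (C + 1)) q).
  - f_equal. f_equal. replace (2 * (C + 1)) with ((C + 1) + (C + 1)) by lia.
    rewrite seq_app, flat_map_app. unfold round. rewrite rev_involutive. f_equal.
    + rewrite rev_seq_map. apply flat_map_singleton.
      intros i Hi. now destruct (acc_first j i Hi) as [-> ->].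
    + rewrite <- (map_sub_seq (C + 1)). apply flat_map_singleton.
      intros i Hi. now destruct (acc_second j i Hi) as [-> ->].
  - intros i. now destruct (gmem_period j i) as [-> ->].
Qed.

Lemma concat_repeat_add {A} (l : list A) a c :
  concat (repeat l a) ++ concat (repeat l c) = concat (repeat l (a + c)).
Proof. now rewrite repeat_app, concat_app. Qed.

(** As [k] is a multiple of the period, every row ends with a complete ascending sweep and the next
    one begins with a descending sweep, so rows concatenate to whole rounds. *)
Lemma accesses_grid b q : placed 0 b -> b + gsize <= N -> k = 2 * (C + 1) * q ->
  accesses (mem L) (seq b gsize) = concat (repeat round (m * q)).
Proof.
  intros Hb Hn Hk2.
  assert (M : forall x v, valid x -> v = b + pos x -> mem L v = gmem x).
  { intros x v Hx ->. now apply placed_mem. }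
  assert (R : forall j, j <= m ->
    accesses (mem L) (seq (b + m) (base (m - j) - m)) = concat (repeat round (j * q))).
  { induction j as [|j IH]; intros Hj.
    - rewrite Nat.sub_0_r, base_m, Nat.sub_diag. reflexivity.
    - pose proof (base_succ (m - S j) ltac:(lia)) as B.
      replace (m - S j + 1) with (m - j) in B by lia.
      pose proof (base_ge (m - j)).
      replace (base (m - S j) - m) with (base (m - j) - m + (1 + 3 * k)) by lia.
      rewrite seq_app, accesses_app, IH by lia.
      replace (S j * q) with (j * q + q) by lia.
      rewrite <- concat_repeat_add. f_equal. rewrite seq_app, accesses_app.
      rewrite (accesses_none (seq _ 1)).
      + cbn [app]. rewrite <- (acc_XT (m - S j) q), <- Hk2.
        rewrite <- (accesses_columns b Hb Hn (m - S j) k) by lia.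
        f_equal. f_equal. simpl. replace (m - S j + 1) with (m - j) by lia. lia.
      + intros v [<-|[]]. rewrite (M (gE (m - j))); simpl; auto; lia. }
  specialize (R m (le_n m)). rewrite Nat.sub_diag in R.
  pose proof (base_ge 0).
  replace gsize with (m + (base 0 - m + (1 + m))) by (unfold gsize; lia).
  rewrite !seq_app, !accesses_app, R.
  rewrite (accesses_none (seq b m)), (accesses_none (seq (b + m + (base 0 - m) + 1) m)),
    (accesses_none (seq (b + m + (base 0 - m)) 1)).
  - apply app_nil_r.
  - intros v [<-|[]]. rewrite (M (gE 0)); simpl; auto; lia.
  - intros v Hv. apply in_seq in Hv. rewrite (M (gY (v - b - base 0 - 1))); simpl; auto; lia.
  - intros v Hv. apply in_seq in Hv. rewrite (M (gV (v - b))); simpl; auto; lia.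
Qed.

Lemma accesses_placed h b q : placed h b -> b + size h <= N -> k = 2 * (C + 1) * q ->
  accesses (mem L) (seq b (size h)) = concat (repeat round (2 ^ h * (m * q))).
Proof.
  intros H Hn Hk2. revert b H Hn. induction h as [|h IH]; intros b H Hn.
  - rewrite Nat.mul_1_l. now apply accesses_grid.
  - destruct (placed_succ _ _ H) as (_ & _ & (M1 & M2) & P1 & P2).
    cbn [size] in *. replace (2 * size h + 2) with (1 + (size h + (size h + 1))) by lia.
    rewrite !seq_app, !accesses_app, (IH _ P1) by lia.
    replace (b + 1 + size h) with (b + size h + 1) by lia. rewrite (IH _ P2) by lia.
    rewrite (accesses_none (seq b 1)), (accesses_none (seq (b + size h + 1 + size h) 1)).
    + rewrite app_nil_r. cbn [app]. rewrite concat_repeat_add. f_equal. f_equal. simpl. lia.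
    + intros v [<-|[]]. rewrite <- M2. f_equal. lia.
    + intros v [<-|[]]. auto.
Qed.

(** * The parallel execution *)

Variable P : nat.

Lemma run_done s E s' : ws_run G P s E s' -> done s' = rev (map snd E) ++ done s.
Proof.
  induction 1 as [|s p v s1 E s2 H1 H2 IH|s s1 E s2 H1 H2 IH]; auto.
  - apply step_done in H1 as [H1 _]. simpl. now rewrite IH, H1, <- app_assoc.
  - apply step_done in H1. congruence.
Qed.

Lemma run_NoDup s E s' : ws_run G P s E s' ->
  NoDup (map snd E) /\ forall v, In v (map snd E) -> ~ In v (done s).
Proof.
  induction 1 as [|s p v s1 E s2 H1 H2 [IH1 IH2]|s s1 E s2 H1 H2 [IH1 IH2]].
  - split; [constructor|intros v []].
  - apply step_done in H1 as [H1 H3]. rewrite H1 in IH2. simpl. split.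
    + constructor; auto. intros Q. apply IH2 in Q. apply Q. now left.
    + intros w [<-|Hw]; auto. intros Q. apply (IH2 w Hw). now right.
  - apply step_done in H1. rewrite <- H1. auto.
Qed.

(** Equality of nodes spelled out as equations between indices, so that the effect of executing a
    node on the counters of a [stage] is left to linear arithmetic. *)
Definition same x y :=
  match x, y with
  | gV j, gV j' | gE j, gE j' | gY j, gY j' => j = j'
  | gF j i, gF j' i' | gX j i, gX j' i' | gT j i, gT j' i' => j = j' /\ i = i'
  | _, _ => False
  end.

Lemma same_iff x y : same x y <-> x = y.
Proof.
  split; [|intros ->; destruct y; simpl; auto].
  destruct x, y; simpl; try tauto; intros; f_equal; tauto.
Qed.

(* For each kind of node, the nodes executed so far form an initial segment of the
   lexicographic order. *)
Record stage := mkStage {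
  nv : nat; fj : nat; fi : nat; xj : nat; xi : nat; ne : nat; tj : nat; ti : nat; ny : nat }.

Definition executed s x :=
  match x with
  | gV j => j < nv s
  | gE j => j < ne s
  | gF j i => j < fj s \/ j = fj s /\ i < fi s
  | gX j i => j < xj s \/ j = xj s /\ i < xi s
  | gT j i => j < tj s \/ j = tj s /\ i < ti s
  | gY j => j < ny s
  end.

(** * A grid executed by its owner and one thief *)

Section GridPar.
Variables (b : nat) (Hb : placed 0 b) (Hn : b + gsize <= N).

Definition inv D s := forall x, valid x -> (In (b + pos x) D <-> executed s x).

Lemma inv_exec D s x s' : inv D s -> valid x ->
  (forall y, valid y -> executed s' y <-> same y x \/ executed s y) ->
  inv ((b + pos x) :: D) s'.
Proof.
  intros H Hx E y Hy. specialize (H y Hy). rewrite E by auto. rewrite same_iff, <- H.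
  simpl. split.
  - intros [Q|Q]; [left|right; auto]. apply pos_inj; auto. lia.
  - intros [->|Q]; auto.
Qed.

Lemma inv_ext D s s' : inv D s -> (forall y, valid y -> executed s' y <-> executed s y) ->
  inv D s'.
Proof. intros H E y Hy. rewrite E by auto. now apply H. Qed.

Lemma inv_in D s y u : inv D s -> valid y -> executed s y -> u = b + pos y -> In u D.
Proof. intros H Hy Q ->. now apply H. Qed.

Lemma inv_notin D s y u : inv D s -> valid y -> ~ executed s y -> u = b + pos y -> ~ In u D.
Proof. intros H Hy Q -> R. apply Q. now apply H. Qed.

Ltac stage_ext := let y := fresh "y" in let Hy := fresh "Hy" in
  intros y Hy; destruct y; simpl in *; lia.

Lemma grid_ready D x : valid x -> x <> gV 0 ->
  match ginn x with
  | Root => True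
  | Spawned => In (b + pos x - 1) D
  | RightOf r => In (b + pos x - r) D
  | Join d => In (b + pos x - 1) D /\ In (b + pos x - d) D
  end -> ready G D (b + pos x).
Proof.
  intros Hx Nx H. apply (ready_inn N L W); [now apply grid_lt|].
  now rewrite (placed_inn b x).
Qed.

Lemma ready_V D s j : inv D s -> j + 1 < m -> j < nv s -> ready G D (b + pos (gV (j + 1))).
Proof.
  intros H Hj Q. apply grid_ready; [simpl; lia|intros E; injection E; lia|].
  cbn [ginn]. destruct (j + 1) eqn:E; [lia|]. eapply (inv_in _ _ (gV j)); eauto; simpl; lia.
Qed.

Lemma ready_F D s j i : inv D s -> j < m -> i < k -> j < nv s -> executed s (gF j (i - 1)) \/ i = 0 ->
  ready G D (b + pos (gF j i)).
Proof.
  intros H Hj Hi Q1 Q2. apply grid_ready; [simpl; lia|discriminate|].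
  pose proof (base_ge (j + 1)). destruct i as [|i]; cbn [ginn].
  - eapply (inv_in _ _ (gV j)); eauto; simpl; lia.
  - destruct Q2 as [Q2|]; [|lia]. replace (S i - 1) with i in Q2 by lia.
    eapply (inv_in _ _ (gF j i)); eauto; simpl; lia.
Qed.

Lemma ready_X D s j i : inv D s -> j < m -> i < k -> executed s (gF j i) ->
  ready G D (b + pos (gX j i)).
Proof.
  intros H Hj Hi Q. apply grid_ready; [simpl; lia|discriminate|]. cbn [ginn].
  eapply (inv_in _ _ (gF j i)); eauto; simpl; lia.
Qed.

Lemma ready_T D s j i : inv D s -> j < m -> i < k -> executed s (gX j i) ->
  executed s (gT j (i - 1)) \/ i = 0 -> j + 1 < ne s -> ready G D (b + pos (gT j i)).
Proof.
  intros H Hj Hi Q1 Q2 Q3. apply grid_ready; [simpl; lia|discriminate|]. cbn [ginn]. split.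
  - eapply (inv_in _ _ (gX j i)); eauto; simpl; lia.
  - destruct i as [|i].
    + eapply (inv_in _ _ (gE (j + 1))); eauto; simpl; lia.
    + destruct Q2 as [Q2|]; [|lia]. replace (S i - 1) with i in Q2 by lia.
      eapply (inv_in _ _ (gT j i)); eauto; simpl; lia.
Qed.

Lemma ready_E D s j : inv D s -> j < m -> executed s (gF j (k - 1)) ->
  ready G D (b + pos (gE j)).
Proof.
  intros H Hj Q. apply grid_ready; [simpl; lia|discriminate|]. cbn [ginn].
  destruct (Nat.eqb_spec j m); [lia|]. pose proof (base_succ j Hj).
  eapply (inv_in _ _ (gF j (k - 1))); eauto; simpl; lia.
Qed.

Lemma ready_Em D s : inv D s -> m <= nv s -> ready G D (b + pos (gE m)).
Proof.
  intros H Q. apply grid_ready; [simpl; lia|discriminate|]. cbn [ginn].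
  rewrite Nat.eqb_refl. eapply (inv_in _ _ (gV (m - 1))); eauto; simpl; try lia.
  rewrite base_m. lia.
Qed.

Lemma ready_Y D s j : inv D s -> j < m -> j <= ny s -> 1 <= ne s -> executed s (gT j (k - 1)) ->
  ready G D (b + pos (gY j)).
Proof.
  intros H Hj Q1 Q2 Q3. apply grid_ready; [simpl; lia|discriminate|]. cbn [ginn].
  pose proof (T_lt_Y j Hj). split.
  - destruct j as [|j].
    + eapply (inv_in _ _ (gE 0)); eauto; simpl; lia.
    + eapply (inv_in _ _ (gY j)); eauto; simpl; lia.
  - eapply (inv_in _ _ (gT j (k - 1))); eauto; simpl in *; lia.
Qed.

(** The exit of the block is excluded: a grid run stops when the exit is assigned to a processor,
    because what follows it depends on the surrounding tree. *)
Definition inb (v : nat) := b <= v < b + gsize - 1.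

Lemma inb_pos x : valid x -> x <> gY (m - 1) -> inb (b + pos x).
Proof.
  intros Hx Nx. pose proof (pos_bound x Hx). unfold inb.
  assert (pos x <> pos (gY (m - 1))) by (intros E; apply Nx, pos_inj; auto; simpl; lia).
  simpl pos in H0 at 2. unfold gsize in *. lia.
Qed.

Lemma par_spine p D0 c d j : p < P -> j <= m -> c p = Some b -> d p = [] ->
  (forall v, b <= v < b + gsize -> ~ In v D0) -> ready G D0 b ->
  exists D, ws_run G P (mkS c d D0) (map (pair p) (seq b j))
    (mkS (upd c p (Some (b + j))) (upd d p (rev (rows b j))) D) /\
  inv D (mkStage j 0 0 0 0 0 0 0 0).
Proof.
  intros Hp Hj Hc Hd Hf Hr. induction j as [|j IH].
  - exists D0. split.
    + rewrite Nat.add_0_r, !upd_same by auto. constructor.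
    + intros x Hx. pose proof (pos_bound x Hx). split.
      * intros Q. exfalso. eapply Hf; [|apply Q]. lia.
      * intros Q. exfalso. destruct x; simpl in Q; lia.
  - destruct IH as (D & R & I); [lia|]. exists ((b + j) :: D). split.
    + rewrite seq_S, map_app. eapply run_app; [exact R|]. cbn [map]. apply run_one.
      change (b + j) with (b + pos (gV j)) at 3.
      replace (S j) with (j + 1) by lia. rewrite rows_succ.
      pose proof (base_ge (j + 1)).
      replace (b + pos (gF j 0)) with (b + j + (base (j + 1) + 1 - j)) by (simpl; lia).
      pose proof (exec_fork N L P (upd c p (Some (b + j))) (upd d p (rev (rows b j))) D p (b + j)
        (base (j + 1) + 1 - j) Hp (upd_eq _ _ _)) as Stp.
      rewrite !upd_upd, upd_eq in Stp. rewrite Nat.add_assoc. apply Stp; clear Stp.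
      * apply (grid_lt b Hn (gV j)). simpl; lia.
      * apply (inv_notin D _ (gV j) _ I); simpl; lia.
      * destruct j as [|j].
        (* The trace so far is empty and scheduling actions execute nothing, so [D] equals [D0] and
           readiness of the first node is the hypothesis. *)
        -- rewrite Nat.add_0_r. simpl in R. inversion R; subst; [auto|].
           apply step_done in H0. apply run_done in H1. simpl in H0, H1.
           rewrite H1, H0. exact Hr.
        -- replace (b + S j) with (b + pos (gV (j + 1))) by (simpl; lia).
           eapply ready_V; eauto; simpl; lia.
      * change (b + j) with (b + pos (gV j)). pout.
    + change (b + j) with (b + pos (gV j)). eapply inv_exec; [exact I|simpl; lia|stage_ext].
Qed.

Definition xrow j i := flat_map (fun i => [b + pos (gF j i); b + pos (gX j i)]) (seq 0 i).

(** [ne s = j] says that [gE (j + 1)] has not been executed, so [gT j 0] is blocked, and with it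
    every later [gT j i]. After each [gX j i] the processor thus pops the one node in its deque, the
    next fork of the row. *)
Lemma par_xrow q c d D j i s : q < P -> j < m -> i <= k ->
  c q = Some (b + pos (gF j 0)) -> d q = [] ->
  inv D s -> nv s = m -> fj s = j -> fi s = 0 -> xj s = j -> xi s = 0 -> ne s = j ->
  tj s <= j -> ti s = 0 ->
  exists D', ws_run G P (mkS c d D) (map (pair q) (xrow j i))
    (mkS (upd c q (Some (b + pos (gF j 0) + 3 * i))) d D') /\
    inv D' (mkStage m j i j i j (tj s) 0 (ny s)).
Proof.
  intros Hq Hj Hi Hc Hd I E1 E2 E3 E4 E5 E6 E7 E8. induction i as [|i IH].
  - exists D. split.
    + rewrite Nat.add_0_r, upd_same by auto. constructor.
    + eapply inv_ext; eauto. intros y Hy; destruct y; simpl in *; subst; lia.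
  - destruct IH as (D1 & R & I1); [lia|].
    exists ((b + pos (gX j i)) :: (b + pos (gF j i)) :: D1).
    assert (I2 : inv ((b + pos (gF j i)) :: D1) (mkStage m j (S i) j i j (tj s) 0 (ny s))).
    { eapply inv_exec; [exact I1|..]; [simpl; lia|stage_ext]. }
    split.
    2:{ eapply inv_exec; [exact I2|simpl; lia|stage_ext]. }
    unfold xrow in *. rewrite seq_S, flat_map_app, map_app. eapply run_app; [exact R|].
    cbn [flat_map map app]. rewrite Nat.add_0_l.
    replace (b + pos (gF j 0) + 3 * i) with (b + pos (gF j i)) by (simpl; lia).
    replace (b + pos (gF j 0) + 3 * S i) with (b + pos (gF j i) + 3) by (simpl; lia).
    assert (LT : forall x, valid x -> b + pos x < N) by (intros; now apply grid_lt).
    eapply run_exec; [apply (exec_fork N L) with (r := 3)|].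
    { auto. } { apply upd_eq. } { apply LT; simpl; lia. }
    { eapply inv_notin; [exact I1| | |reflexivity]; simpl; lia. }
    { eapply ready_F; [exact I1|..]; simpl; lia. }
    { pout. }
    rewrite upd_upd, Hd.
    replace (b + pos (gF j i) + 1) with (b + pos (gX j i)) by (simpl; lia).
    eapply run_exec; [apply (exec_next_wait N L W) with (e := 3)|].
    { auto. } { apply upd_eq. } { apply LT; simpl; lia. }
    { eapply inv_notin; [exact I2| | |reflexivity]; simpl; lia. }
    { eapply ready_X; [exact I2|..]; simpl; lia. }
    { pout. }
    { replace (b + pos (gX j i) + 1) with (b + pos (gT j i)) by (simpl; lia).
      rewrite placed_inn; auto; [simpl; lia|discriminate]. }
    { destruct i as [|i].
      - eapply (inv_notin _ _ (gE (j + 1))); [exact I2|..]; simpl; lia.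
      - eapply (inv_notin _ _ (gT j i)); [exact I2|..]; simpl; lia. }
    rewrite upd_upd. apply run_idle.
    pose proof (st_pop G P (mkS (upd c q None) (upd d q [b + pos (gF j i) + 3])
      (b + pos (gX j i) :: b + pos (gF j i) :: D1)) q _ [] Hq (upd_eq _ _ _) (upd_eq _ _ _)) as Stp.
    cbn [cur dq done] in Stp. rewrite !upd_upd, (upd_same d q []) in Stp by auto. exact Stp.
Qed.

Definition trow j := map (fun i => b + pos (gT j i)) (seq 0 k).

(** All [gX j i] are done, so each [gT j i] makes the next one ready. The cascade ends with [gY j]
    assigned, since its local parent, [gY (j - 1)] or [gE 0], is done too. *)
Lemma par_trow q c d D j s : q < P -> j < m ->
  c q = Some (b + pos (gT j 0)) -> inv D s -> xj s = j + 1 -> j + 1 < ne s ->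
  tj s = j -> ti s = 0 -> ny s = j ->
  exists D', ws_run G P (mkS c d D) (map (pair q) (trow j))
    (mkS (upd c q (Some (b + pos (gY j)))) d D') /\
    inv D' (mkStage (nv s) (fj s) (fi s) (xj s) (xi s) (ne s) (j + 1) 0 (ny s)).
Proof.
  intros Hq Hj Hc I E1 E2 E3 E4 E5.
  assert (LT : forall x, valid x -> b + pos x < N) by (intros; now apply grid_lt).
  set (st i := mkStage (nv s) (fj s) (fi s) (xj s) (xi s) (ne s) j i (ny s)).
  assert (K : forall i, i + 1 <= k -> exists D', ws_run G P (mkS c d D)
    (map (pair q) (map (fun i => b + pos (gT j i)) (seq 0 i)))
    (mkS (upd c q (Some (b + pos (gT j i)))) d D') /\ inv D' (st i)).
  { induction i as [|i IH]; intros Hi.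
    - exists D. split.
      + rewrite upd_same by auto. constructor.
      + eapply inv_ext; eauto. unfold st. intros y Hy; destruct y; simpl in *; lia.
    - destruct IH as (D1 & R & I1); [lia|]. exists ((b + pos (gT j i)) :: D1). split.
      2:{ eapply inv_exec; [exact I1|..]; [simpl; lia|unfold st in *; stage_ext]. }
      rewrite seq_S, !map_app. eapply run_app; [exact R|]. cbn [map]. rewrite Nat.add_0_l.
      apply run_one.
      pose proof (exec_touch N L W P (upd c q (Some (b + pos (gT j i)))) d D1 q
        (b + pos (gT j i)) 3 Hq (upd_eq _ _ _)) as Stp. rewrite upd_upd in Stp.
      replace (b + pos (gT j (S i))) with (b + pos (gT j i) + 3) by (simpl; lia).
      apply Stp; clear Stp.
      + apply LT; simpl; lia.
      + eapply inv_notin; [exact I1| | |reflexivity]; simpl; lia.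
      + eapply ready_T; [exact I1|..]; simpl; lia.
      + apply out_T; auto; lia.
      + eapply (inv_in _ _ (gX j (S i))); [exact I1|..]; simpl; lia. }
  destruct (K (k - 1)) as (D1 & R & I1); [lia|]. exists ((b + pos (gT j (k - 1))) :: D1).
  split.
  2:{ eapply inv_exec; [exact I1|..]; [simpl; lia|unfold st in *; stage_ext]. }
  unfold trow. replace k with (S (k - 1)) at 1 by lia.
  rewrite seq_S, !map_app. eapply run_app; [exact R|]. cbn [map]. rewrite Nat.add_0_l.
  apply run_one. pose proof (T_lt_Y j Hj).
  pose proof (exec_touch N L W P (upd c q (Some (b + pos (gT j (k - 1))))) d D1 q
    (b + pos (gT j (k - 1))) (pos (gY j) - pos (gT j (k - 1))) Hq (upd_eq _ _ _)) as Stp.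
  rewrite upd_upd in Stp.
  replace (b + pos (gT j (k - 1)) + (pos (gY j) - pos (gT j (k - 1))))
    with (b + pos (gY j)) in Stp by lia.
  apply Stp; clear Stp.
  - apply LT; simpl; lia.
  - eapply inv_notin; [exact I1| | |reflexivity]; simpl; lia.
  - eapply ready_T; [exact I1|..]; simpl; lia.
  - now apply out_T_last.
  - destruct j as [|j].
    + eapply (inv_in _ _ (gE 0)); [exact I1|..]; simpl in *; lia.
    + eapply (inv_in _ _ (gY j)); [exact I1|..]; simpl in *; lia.
Qed.

Variable z : nat.
Hypothesis (Hz : k = 2 * (C + 1) * z) (HC : 1 <= C).
Let M := (z - 1) * S C.

(** Sequentially [gF j (i + 1)] follows [gT j i]; here it is popped right after [gX j i], so every
    fork of the row except the first is a deviation. *)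
Lemma devl_xrow q j i a :
  i - 1 <= length (devl (map (pair q)
    (flat_map (fun i => [b + pos (gF j i); b + pos (gX j i)]) (seq a i)))).
Proof.
  revert a. induction i as [|i IH]; intros a; [simpl; lia|].
  destruct i as [|i]; [simpl; lia|]. specialize (IH (S a)).
  cbn [seq flat_map map app] in *. etransitivity; [|apply devl_cons].
  rewrite devl_cons2. rewrite Nat.eqb_refl.
  destruct (Nat.eqb_spec (b + pos (gF j (S a))) (b + pos (gX j a) + 1)); [simpl in *; lia|].
  destruct (Nat.eqb_spec (b + pos (gF j (S a))) 0); [simpl in *; lia|].
  cbn [andb negb length]. lia.
Qed.

Lemma misses_xrow q j : j < m -> misses_at_least G C (map (pair q) (xrow j k)) M.
Proof.
  intros Hj. apply (misses_at_least_sweeps G C q _ (rev (seq 0 (C + 1)))); auto.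
  { apply sweep_rev, sweep_seq. }
  rewrite <- (acc_X j z), <- Hz. unfold xrow.
  assert (K : forall i, i <= k -> accesses (mem L)
    (flat_map (fun i => [b + pos (gF j i); b + pos (gX j i)]) (seq 0 i)) =
    flat_map (fun i => acc (gmem (gX j i))) (seq 0 i)).
  { induction i as [|i IH]; intros Hi; auto.
    rewrite seq_S, !flat_map_app, accesses_app, IH by lia. f_equal.
    unfold accesses. cbn [flat_map app]. rewrite Nat.add_0_l.
    rewrite !(placed_mem b) by (auto; simpl; lia).
    change (gmem (gF j i)) with (@None nat). unfold acc. now rewrite !app_nil_r. }
  now apply K.
Qed.

Lemma misses_trow q j : j < m -> misses_at_least G C (map (pair q) (trow j)) M.
Proof.
  intros Hj. apply (misses_at_least_sweeps G C q _ (seq 0 (C + 1))); auto.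
  { apply sweep_seq. }
  rewrite <- (acc_T j z), <- Hz. unfold trow.
  assert (K : forall i, i <= k -> accesses (mem L) (map (fun i => b + pos (gT j i)) (seq 0 i)) =
    flat_map (fun i => acc (gmem (gT j i))) (seq 0 i)).
  { induction i as [|i IH]; intros Hi; auto.
    rewrite seq_S, map_app, flat_map_app, accesses_app, IH by lia. f_equal.
    unfold accesses. cbn [flat_map map app]. rewrite Nat.add_0_l.
    rewrite !(placed_mem b) by (auto; simpl; lia). unfold acc. now rewrite !app_nil_r. }
  now apply K.
Qed.

Lemma inb_xrow q j : j < m -> Forall inb (map (@snd nat nat) (map (pair q) (xrow j k))).
Proof.
  intros Hj. rewrite map_map, map_id. apply Forall_forall. intros v Hv.
  apply in_flat_map in Hv as (i & Hi & Hv). apply in_seq in Hi.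
  destruct Hv as [<-|[<-|[]]]; (apply inb_pos; [simpl; lia|discriminate]).
Qed.

Lemma inb_trow q j : j < m -> Forall inb (map (@snd nat nat) (map (pair q) (trow j))).
Proof.
  intros Hj. rewrite map_map, map_id. apply Forall_forall. intros v Hv.
  apply in_map_iff in Hv as (i & <- & Hi). apply in_seq in Hi.
  apply inb_pos; [simpl; lia|discriminate].
Qed.

Definition rows_from j := map (fun j => b + pos (gF j 0)) (seq j (m - j)).

(** The state just before row [j] is stolen. The touches of row [j - 1] are still pending, hence
    [j - 1] in the counters of [gT] and [gY]; truncated subtraction gives the right value for
    [j = 0]. *)
Definition row_stage j := mkStage m j 0 j 0 j (j - 1) 0 (j - 1).

(** At the end of row [j] the node [gE j] releases the touches of row [j - 1]. The thief runs them
    and [gY (j - 1)], then is blocked at [gY j] and idle again. Row 0 has no such cascade, which is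
    why it contributes [M] only once. *)
Lemma par_row p q c d D j : p < P -> q < P -> p <> q -> j < m ->
  c q = None -> d q = [] -> d p = rev (rows_from j) -> inv D (row_stage j) ->
  exists E D', ws_run G P (mkS c d D) E (mkS c (upd d p (rev (rows_from (S j)))) D') /\
    inv D' (row_stage (S j)) /\ Forall inb (map snd E) /\ k - 1 <= length (devl E) /\
    misses_at_least G C E (M + (if j =? 0 then 0 else M)).
Proof.
  intros Hp Hq Hpq Hj Hc Hdq Hdp I.
  assert (LT : forall x, valid x -> b + pos x < N) by (intros; now apply grid_lt).
  set (d1 := upd d p (rev (rows_from (S j)))).
  assert (Hd1 : d1 q = []) by (unfold d1; now rewrite upd_neq by auto).
  assert (R0 : ws_step G P (mkS c d D) None (mkS (upd c q (Some (b + pos (gF j 0)))) d1 D)).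
  { apply (st_steal G P (mkS c d D)); auto. cbn [dq]. rewrite Hdp. unfold rows_from.
    replace (m - j) with (S (m - S j)) by lia. reflexivity. }
  destruct (par_xrow q (upd c q (Some (b + pos (gF j 0)))) d1 D j k (row_stage j))
    as (D1 & R1 & I1); auto; try (simpl; lia).
  { apply upd_eq. }
  rewrite upd_upd in R1. cbn [tj ny row_stage] in I1.
  replace (b + pos (gF j 0) + 3 * k) with (b + pos (gE j)) in R1
    by (simpl; pose proof (base_succ j Hj); lia).
  set (s2 := mkStage m j k j k (j + 1) (j - 1) 0 (j - 1)).
  assert (I2 : inv (b + pos (gE j) :: D1) s2).
  { eapply inv_exec; [exact I1|simpl; lia|unfold s2; stage_ext]. }
  assert (FE : ~ In (b + pos (gE j)) D1).
  { eapply inv_notin; [exact I1| | |reflexivity]; simpl; lia. }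
  assert (RE : ready G D1 (b + pos (gE j))).
  { eapply ready_E; [exact I1|..]; simpl; lia. }
  assert (VE : valid (gE j)) by (simpl; lia).
  destruct j as [|j].
  - exists (map (pair q) (xrow 0 k) ++ [(q, b + pos (gE 0))]), (b + pos (gE 0) :: D1).
    split; [|split; [|split; [|split]]].
    + eapply run_sched; [exact R0|]. eapply run_app; [exact R1|]. apply run_one.
      pose proof (exec_next_wait N L W P (upd c q (Some (b + pos (gE 0)))) d1 D1 q
        (b + pos (gE 0)) (pos (gY 0) - pos (gT 0 (k - 1))) Hq (upd_eq _ _ _)) as Stp.
      rewrite upd_upd, (upd_same c q None) in Stp by auto.
      pose proof (T_lt_Y 0 Hj).
      apply Stp; auto.
      * pout.
      * replace (b + pos (gE 0) + 1) with (b + pos (gY 0)) by (simpl; lia).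
        rewrite placed_inn; auto; discriminate.
      * eapply (inv_notin _ _ (gT 0 (k - 1))); [exact I1|..]; simpl in *; lia.
    + eapply inv_ext; [exact I2|unfold s2; stage_ext].
    + rewrite map_app. apply Forall_app. split; [now apply inb_xrow|].
      repeat constructor; apply (inb_pos (gE 0)); auto; discriminate.
    + etransitivity; [|apply devl_app_l]. apply devl_xrow.
    + apply misses_at_least_app; [now apply misses_xrow|apply misses_at_least_0].
  - assert (Hj' : j < m) by lia.
    destruct (par_trow q (upd c q (Some (b + pos (gT j 0)))) d1 (b + pos (gE (S j)) :: D1) j s2)
      as (D3 & R3 & I3); auto; try (simpl; lia).
    { apply upd_eq. }
    rewrite upd_upd in R3. cbn in I3.
    exists (map (pair q) (xrow (S j) k) ++ [(q, b + pos (gE (S j)))] ++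
      map (pair q) (trow j) ++ [(q, b + pos (gY j))]), (b + pos (gY j) :: D3).
    split; [|split; [|split; [|split]]].
    + eapply run_sched; [exact R0|]. eapply run_app; [exact R1|].
      eapply run_app; [|eapply run_app; [exact R3|]]; apply run_one.
      * pose proof (exec_touch N L W P (upd c q (Some (b + pos (gE (S j))))) d1 D1 q
          (b + pos (gE (S j))) 3 Hq (upd_eq _ _ _)) as Stp.
        rewrite upd_upd in Stp.
        replace (b + pos (gT j 0)) with (b + pos (gE (S j)) + 3)
          by (simpl; replace (j + 1) with (S j) by lia; lia).
        apply Stp; auto.
        -- pout.
        -- eapply (inv_in _ _ (gX j 0)); [exact I1|..]; simpl; try lia.
           replace (j + 1) with (S j) by lia. lia.
      * pose proof (exec_next_wait N L W P (upd c q (Some (b + pos (gY j)))) d1 D3 q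
          (b + pos (gY j)) (pos (gY (S j)) - pos (gT (S j) (k - 1))) Hq (upd_eq _ _ _)) as Stp.
        rewrite upd_upd, (upd_same c q None) in Stp by auto.
        pose proof (T_lt_Y (S j) Hj).
        apply Stp; auto.
        -- eapply inv_notin; [exact I3| | |reflexivity]; simpl; lia.
        -- eapply ready_Y; [exact I3|..]; simpl; lia.
        -- pout. destruct (Nat.ltb_spec (j + 1) m); [auto|lia].
        -- replace (b + pos (gY j) + 1) with (b + pos (gY (S j))) by (simpl; lia).
           rewrite placed_inn; auto; discriminate.
        -- eapply (inv_notin _ _ (gT (S j) (k - 1))); [exact I3|..]; simpl in *; lia.
    + eapply inv_ext.
      * eapply (inv_exec _ _ (gY j) (mkStage m (S j) k (S j) k (S j + 1) (j + 1) 0 (j + 1)));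
          [exact I3|simpl; lia|stage_ext].
      * stage_ext.
    + rewrite !map_app, !Forall_app. repeat split.
      * now apply inb_xrow.
      * repeat constructor; apply (inb_pos (gE (S j))); auto; discriminate.
      * now apply inb_trow.
      * constructor; [|constructor]. apply (inb_pos (gY j)); simpl; auto.
        intros Q; injection Q; lia.
    + etransitivity; [|apply devl_app_l]. apply devl_xrow.
    + apply misses_at_least_app; [now apply misses_xrow|].
      apply (misses_at_least_app _ _ _ _ 0 M); [apply misses_at_least_0|].
      rewrite <- (Nat.add_0_r M).
      apply misses_at_least_app; [now apply misses_trow|apply misses_at_least_0].
Qed.

Lemma par_rows p q c d D j : p < P -> q < P -> p <> q -> j <= m ->
  c q = None -> d q = [] -> d p = rev (rows_from 0) -> inv D (row_stage 0) ->
  exists E D', ws_run G P (mkS c d D) E (mkS c (upd d p (rev (rows_from j))) D') /\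
    inv D' (row_stage j) /\ Forall inb (map snd E) /\ j * (k - 1) <= length (devl E) /\
    misses_at_least G C E ((j + (j - 1)) * M).
Proof.
  intros Hp Hq Hpq Hj Hc Hdq Hdp I. induction j as [|j IH].
  - exists [], D. rewrite upd_same by auto. split; [constructor|]. split; [auto|].
    split; [constructor|]. split; [simpl; lia|]. apply misses_at_least_0.
  - destruct IH as (E1 & D1 & R1 & I1 & F1 & V1 & M1); [lia|].
    destruct (par_row p q c (upd d p (rev (rows_from j))) D1 j)
      as (E2 & D2 & R2 & I2 & F2 & V2 & M2); auto.
    { now rewrite upd_neq by auto. }
    { apply upd_eq. }
    rewrite upd_upd in R2. exists (E1 ++ E2), D2. split; [|split; [|split; [|split]]].
    + eapply run_app; eauto.
    + auto.
    + rewrite map_app, Forall_app. auto.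
    + etransitivity; [|apply devl_app]. lia.
    + replace ((S j + (S j - 1)) * M) with ((j + (j - 1)) * M + (M + (if j =? 0 then 0 else M))).
      * now apply misses_at_least_app.
      * destruct j; simpl; [lia|]. rewrite Nat.sub_0_r. lia.
Qed.

(** While the thief takes all rows, the owner holds the innermost thread [gE m] unexecuted.
    Executing it at the end releases the touches of row [m - 1] and brings the owner to the exit. *)
Lemma par_grid p q c d D0 : p < P -> q < P -> p <> q ->
  c p = Some b -> c q = None -> d p = [] -> d q = [] ->
  (forall v, b <= v < b + gsize -> ~ In v D0) -> ready G D0 b ->
  exists E D, ws_run G P (mkS c d D0) E (mkS (upd c p (Some (b + gsize - 1))) d D) /\
    (forall v, inb v -> In v D) /\ Forall inb (map snd E) /\ m * (k - 1) <= length (devl E) /\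
    misses_at_least G C E (2 * m * M).
Proof.
  intros Hp Hq Hpq Hcp Hcq Hdp Hdq Hf Hr.
  assert (LT : forall x, valid x -> b + pos x < N) by (intros; now apply grid_lt).
  destruct (par_spine p D0 c d m) as (D1 & R1 & I1); auto.
  destruct (par_rows p q (upd c p (Some (b + m))) (upd d p (rev (rows b m))) D1 m)
    as (E2 & D2 & R2 & I2 & F2 & V2 & M2); auto.
  { now rewrite upd_neq by auto. }
  { now rewrite upd_neq by auto. }
  { rewrite upd_eq. unfold rows, rows_from. now rewrite Nat.sub_0_r. }
  rewrite upd_upd in R2. unfold rows_from in R2 at 1. rewrite Nat.sub_diag in R2.
  cbn [seq map rev] in R2. rewrite (upd_same d p []) in R2 by auto.
  set (s2 := mkStage m m 0 m 0 (m + 1) (m - 1) 0 (m - 1)).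
  assert (I3 : inv (b + pos (gE m) :: D2) s2).
  { eapply inv_exec; [exact I2|simpl; lia|unfold s2; stage_ext]. }
  destruct (par_trow p (upd c p (Some (b + pos (gT (m - 1) 0)))) d (b + pos (gE m) :: D2) (m - 1) s2)
    as (D3 & R3 & I4); auto; try (simpl; lia).
  { apply upd_eq. }
  rewrite upd_upd in R3. cbn in I4.
  exists (map (pair p) (seq b m) ++ E2 ++ [(p, b + pos (gE m))] ++ map (pair p) (trow (m - 1))), D3.
  split; [|split; [|split; [|split]]].
  - eapply run_app; [exact R1|]. eapply run_app; [exact R2|].
    replace (b + gsize - 1) with (b + pos (gY (m - 1))) by (unfold gsize; simpl; lia).
    eapply run_app; [|exact R3]. apply run_one.
    pose proof (exec_touch N L W P (upd c p (Some (b + m))) d D2 p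
      (b + pos (gE m)) 3 Hp) as Stp.
    rewrite upd_upd in Stp.
    replace (b + pos (gT (m - 1) 0)) with (b + pos (gE m) + 3)
      by (simpl; replace (m - 1 + 1) with m by lia; lia).
    apply Stp; auto.
    + rewrite upd_eq. simpl. now rewrite base_m.
    + apply LT; simpl; lia.
    + eapply inv_notin; [exact I2| | |reflexivity]; simpl; lia.
    + eapply ready_Em; [exact I2|]; simpl; lia.
    + rewrite placed_out; auto; [|simpl; lia|discriminate]. destruct m; [lia|reflexivity].
    + eapply (inv_in _ _ (gX (m - 1) 0)); [exact I2|..]; simpl; try lia.
      replace (m - 1 + 1) with m by lia. lia.
  - intros v Hv. destruct (node_cases (v - b)) as (x & Hx & Q); [unfold inb in Hv; lia|].
    assert (Nx : x <> gY (m - 1)).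
    { intros ->. unfold inb, gsize in Hv. simpl in Q. lia. }
    apply (inv_in _ _ x _ I4); auto; [|unfold inb in Hv; lia].
    destruct x; simpl in *; try lia.
    enough (j <> m - 1) by lia. intros ->. now apply Nx.
  - rewrite !map_app, !Forall_app. repeat split; auto.
    + rewrite map_map, map_id. apply Forall_forall. intros v Hv. apply in_seq in Hv.
      pose proof (base_ge 0). unfold inb, gsize. lia.
    + constructor; [|constructor]. apply (inb_pos (gE m)); simpl; auto. discriminate.
    + apply inb_trow. lia.
  - etransitivity; [exact V2|]. etransitivity; [apply (devl_app_l E2)|].
    apply devl_app_r.
  (* The thief has run all [m] rows of [gX] and [m - 1] rows of [gT]; the owner adds the last row of
     [gT]. *)
  - replace (2 * m * M) with (0 + ((m + (m - 1)) * M + (0 + M))) by nia.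
    apply misses_at_least_app; [apply misses_at_least_0|].
    apply misses_at_least_app; auto.
    apply misses_at_least_app; [apply misses_at_least_0|]. apply misses_trow. lia.
Qed.
End GridPar.

(** By [in_ok], all edges into the exit of a block start inside the block. *)
Lemma exit_ready h b D : placed h b -> b + size h <= N ->
  (forall v, b <= v < b + size h - 1 -> In v D) -> ready G D (b + size h - 1).
Proof.
  intros H Hn HD. pose proof (size_ge h). destruct (placed_wf _ _ H) as [_ I].
  specialize (I (b + size h - 1) ltac:(lia)).
  pose proof (in_cases N L W (b + size h - 1) ltac:(lia)) as I2.
  apply (ready_inn N L W); [lia|]. unfold in_ok in I.
  destruct (inn L (b + size h - 1)); [auto|..]; repeat split; apply HD; lia.
Qed.

(* The helper [q] steals the root of the right subtree and holds it while [p] and the remaining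
   helpers execute the left subtree; these are then idle again and help [q]. *)
Lemma par_placed z h b p Lh c d D0 : k = 2 * (C + 1) * z -> 1 <= C ->
  placed h b -> b + size h <= N -> NoDup (p :: Lh) -> length Lh = h + 1 ->
  (forall x, In x (p :: Lh) -> x < P) -> c p = Some b ->
  (forall x, In x Lh -> c x = None) -> (forall x, In x (p :: Lh) -> d x = []) ->
  (forall v, b <= v < b + size h -> ~ In v D0) -> ready G D0 b ->
  exists E D p', ws_run G P (mkS c d D0) E
    (mkS (upd (upd c p None) p' (Some (b + size h - 1))) d D) /\ In p' (p :: Lh) /\
    (forall v, b <= v < b + size h - 1 -> In v D) /\
    (forall v, In v (map snd E) -> b <= v < b + size h - 1) /\
    2 ^ h * (m * (k - 1)) <= length (devl E) /\
    misses_at_least G C E (2 ^ h * (2 * m * ((z - 1) * S C))).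
Proof.
  intros Hz HC. revert b p Lh c d D0.
  induction h as [|h IH]; intros b p Lh c d D0 H Hn ND HL HP Hcp Hc Hd Hf Hr.
  - destruct Lh as [|q [|]]; try discriminate.
    assert (Hpq : p <> q) by (inversion ND as [|? ? Q]; intros ->; apply Q; now left).
    destruct (par_grid b H Hn z Hz HC p q c d D0) as (E & D & R & D1 & F & V & M);
      auto using in_eq, in_cons.
    exists E, D, p. rewrite upd_upd, !Nat.mul_1_l. repeat split; auto.
    + now left.
    + eapply Forall_forall in F; [|eassumption]. apply F.
    + eapply Forall_forall in F; [|eassumption]. apply F.
  - destruct Lh as [|q L']; [discriminate|].
    destruct (placed_succ _ _ H) as ((O1 & O2 & O3) & (I1 & I2 & I3) & _ & P1 & P2).
    pose proof (size_ge h) as S2. cbn [size] in *. set (n := size h) in *.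
    assert (Hpq : p <> q) by (inversion ND as [|? ? Q]; intros ->; apply Q; now left).
    assert (NDp : NoDup (p :: L')).
    { inversion ND as [|? ? Q1 Q2]; inversion Q2; subst. constructor; auto.
      intros Q; apply Q1; now right. }
    assert (NDq : NoDup (q :: L')) by (inversion ND; auto).
    assert (Np : forall x, In x L' -> x <> p /\ x <> q).
    { intros x Hx. inversion NDp; inversion NDq; subst. split; intros ->; auto. }
    assert (Pp : p < P) by (apply HP; now left).
    assert (Pq : q < P) by (apply HP; right; now left).
    assert (PL : forall x, In x L' -> x < P) by (intros; apply HP; right; now right).
    assert (Dp : d p = []) by (apply Hd; now left).
    assert (Dq : d q = []) by (apply Hd; right; now left).
    assert (DL : forall x, In x L' -> d x = []) by (intros; apply Hd; right; now right).
    assert (Cq : c q = None) by (apply Hc; now left).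
    assert (CL : forall x, In x L' -> c x = None) by (intros; apply Hc; now right).
    simpl in HL.
    set (c2 := upd (upd c p (Some (b + 1))) q (Some (b + n + 1))).
    assert (R0 : ws_run G P (mkS c d D0) [(p, b)] (mkS c2 d (b :: D0))).
    { eapply run_exec.
      - apply (exec_fork N L) with (r := n + 1); auto; [lia|apply Hf; lia].
      - rewrite Dp. apply run_idle.
        (* The immediate steal empties the deque of [p] again, as the induction hypothesis requires
           for the left subtree. *)
        pose proof (st_steal G P (mkS (upd c p (Some (b + 1))) (upd d p [b + (n + 1)]) (b :: D0))
          q p [] (b + (n + 1)) Pq Pp) as Stp.
        cbn [cur dq done] in Stp. rewrite upd_upd, (upd_same d p []), !upd_eq, !upd_neq in Stp by auto.
        rewrite Nat.add_assoc in Stp |- *. apply Stp; auto. }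
    destruct (IH (b + 1) p L' c2 d (b :: D0)) as (E1 & D1 & p1 & R1 & Q1 & A1 & B1 & V1 & M1);
      auto; try lia.
    { intros x [<-|Hx]; auto. }
    { unfold c2. rewrite upd_neq, upd_eq; auto. }
    { intros x Hx. unfold c2. destruct (Np x Hx). rewrite !upd_neq by auto. auto. }
    { intros x [<-|Hx]; auto. }
    { fold n. intros v Hv [Q|Q]; [lia|]. apply (Hf v); [lia|auto]. }
    { apply (ready_inn N L W); [lia|]. rewrite I1. left; lia. }
    fold n in R1, A1, B1. replace (b + 1 + n - 1) with (b + n) in * by lia.
    pose proof (run_done _ _ _ R1) as DE1. cbn [done] in DE1.
    assert (F1 : forall v, b + n <= v < b + (2 * n + 2) -> ~ In v D1).
    { intros v Hv Q. rewrite DE1, in_app_iff, <- in_rev in Q. destruct Q as [Q|[Q|Q]].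
      - apply B1 in Q. lia.
      - lia.
      - apply (Hf v); [lia|auto]. }
    set (c4 := upd (upd c p None) q (Some (b + n + 1))).
    assert (R2 : ws_run G P (mkS (upd (upd c2 p None) p1 (Some (b + n))) d D1)
      [(p1, b + n)] (mkS c4 d (b + n :: D1))).
    { apply run_one.
      pose proof (exec_touch_wait N L W P (upd (upd c2 p None) p1 (Some (b + n))) d D1 p1 (b + n)
        (n + 1)) as Stp.
      rewrite upd_upd in Stp. replace (upd (upd c2 p None) p1 None) with c4 in Stp.
      - apply Stp; auto.
        + destruct Q1 as [<-|Q1]; auto.
        + apply upd_eq.
        + lia.
        + apply F1; lia.
        + replace (b + n) with (b + 1 + size h - 1) by (fold n; lia).
          apply exit_ready; auto; fold n; [lia|].
          intros v Hv. apply A1. lia.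
        + apply F1. lia.
      (* The exit of the left subtree may be held by [p] or by a helper. Either way that processor
         becomes idle, so the resulting assignment is the same. *)
      - assert (Q : p1 = p \/ c p1 = None /\ p1 <> q /\ p1 <> p).
        { destruct Q1 as [<-|Q1]; [now left|right]. destruct (Np _ Q1). auto. }
        unfold c4, c2. extensionality x. unfold upd.
        destruct (Nat.eqb_spec x q), (Nat.eqb_spec x p1), (Nat.eqb_spec x p);
          destruct Q as [Q|(Q & ? & ?)]; congruence. }
    destruct (IH (b + n + 1) q L' c4 d (b + n :: D1)) as (E2 & D2 & p2 & R3 & Q2 & A2 & B2 & V2 & M2);
      auto; try lia.
    { intros x [<-|Hx]; auto. }
    { unfold c4. apply upd_eq. }
    { intros x Hx. unfold c4. destruct (Np x Hx). rewrite !upd_neq by auto. auto. }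
    { intros x [<-|Hx]; auto. }
    { fold n. intros v Hv [Q|Q]; [lia|]. apply (F1 v); [lia|auto]. }
    { apply (ready_inn N L W); [lia|]. rewrite I2. right.
      rewrite DE1, in_app_iff. right. left. lia. }
    fold n in R3, A2, B2. replace (b + n + 1 + n - 1) with (b + 2 * n) in * by lia.
    pose proof (run_done _ _ _ R3) as DE2. cbn [done] in DE2.
    assert (G1 : forall v, b <= v <= b + n -> In v D2).
    { intros v Hv. rewrite DE2. apply in_or_app. right.
      destruct (Nat.eq_dec v (b + n)) as [->|]; [now left|right].
      destruct (Nat.eq_dec v b) as [->|].
      - rewrite DE1. apply in_or_app. right. now left.
      - apply A1. lia. }
    exists ([(p, b)] ++ E1 ++ [(p1, b + n)] ++ E2 ++ [(p2, b + 2 * n)]), (b + 2 * n :: D2), p2.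
    replace (b + (2 * n + 2) - 1) with (b + 2 * n + 1) by lia.
    split; [|split; [|split; [|split; [|split]]]].
    + eapply run_app; [exact R0|]. eapply run_app; [exact R1|]. eapply run_app; [exact R2|].
      eapply run_app; [exact R3|]. apply run_one.
      replace (upd c4 q None) with (upd c p None).
      2:{ unfold c4. rewrite upd_upd, (upd_same (upd c p None) q None); auto. now rewrite upd_neq by auto. }
      pose proof (exec_next N L W P (upd (upd c p None) p2 (Some (b + 2 * n))) d D2 p2
        (b + 2 * n) (n + 1)) as Stp.
      rewrite upd_upd in Stp. apply Stp; auto.
      * destruct Q2 as [<-|Q2]; auto.
      * apply upd_eq.
      * lia.
      * rewrite DE2, in_app_iff, <- in_rev. intros [Q|[Q|Q]]; [apply B2 in Q; lia|lia|].
        revert Q. apply F1. lia.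
      * replace (b + 2 * n) with (b + n + 1 + size h - 1) by (fold n; lia).
        apply exit_ready; auto; fold n; [lia|]. intros v Hv. apply A2. lia.
      * apply G1. lia.
    + right. destruct Q2 as [<-|Q2]; [now left|now right].
    + intros v Hv. destruct (Nat.eq_dec v (b + 2 * n)) as [->|]; [now left|right].
      destruct (le_lt_dec v (b + n)); [apply G1; lia|apply A2; lia].
    + intros v Hv. rewrite !map_app, !in_app_iff in Hv. simpl in Hv.
      destruct Hv as [[Hv|[]]|[Hv|[[Hv|[]]|[Hv|[Hv|[]]]]]];
        try apply B1 in Hv; try apply B2 in Hv; lia.
    + etransitivity; [|apply devl_app_r].
      etransitivity; [|apply devl_app].
      pose proof (devl_app_r [(p1, b + n)] (E2 ++ [(p2, b + 2 * n)])).
      pose proof (devl_app_l E2 [(p2, b + 2 * n)]). simpl Nat.pow. lia.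
    + replace (2 ^ S h * (2 * m * ((z - 1) * S C))) with
        (0 + (2 ^ h * (2 * m * ((z - 1) * S C)) + (0 + (2 ^ h * (2 * m * ((z - 1) * S C)) + 0))))
        by (simpl Nat.pow; lia).
      repeat apply misses_at_least_app; auto using misses_at_least_0.
Qed.

Lemma par_execution z h : k = 2 * (C + 1) * z -> 1 <= C -> placed h 0 -> size h = N -> h + 2 <= P ->
  exists E, ws_execution G P E /\ NoDup (map snd E) /\ (forall v, In v (map snd E) -> v < N) /\
    2 ^ h * (m * (k - 1)) <= length (devl E) /\
    2 ^ h * (2 * m * ((z - 1) * S C)) <= misses G C E.
Proof.
  intros Hz HC H Hn HP. pose proof (size_ge h) as S2.
  (* Processor 0 enters the root; the [h + 1] helpers are one for each level of the tree and the
     thief of the grids. *)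
  destruct (par_placed z h 0 0 (seq 1 (h + 1)) (cur (ws_init G)) (fun _ => []) [])
    as (E & D & p & R & Q & A & B & V & M); auto; try lia.
  { apply (seq_NoDup (S (h + 1)) 0). }
  { apply length_seq. }
  { intros x Hx. change (0 :: seq 1 (h + 1)) with (seq 0 (S (h + 1))) in Hx.
    apply in_seq in Hx. lia. }
  { intros x Hx. apply in_seq in Hx. simpl. destruct (Nat.eqb_spec x 0); [lia|auto]. }
  { apply (ready_inn N L W); [lia|]. now rewrite (wf_root _ _ W). }
  rewrite Hn in *. simpl in R, A, B.
  assert (R' : ws_run G P (ws_init G) (E ++ [(p, N - 1)])
    (mkS (upd (upd (cur (ws_init G)) 0 None) p None) (fun _ => []) (N - 1 :: D))).
  { eapply run_app; [exact R|]. apply run_one.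
    pose proof (exec_stop N L W P (upd (upd (cur (ws_init G)) 0 None) p (Some (N - 1)))
      (fun _ => []) D p (N - 1)) as Stp.
    rewrite upd_upd in Stp. apply Stp.
    - change (0 :: seq 1 (h + 1)) with (seq 0 (S (h + 1))) in Q. apply in_seq in Q. lia.
    - apply upd_eq.
    - lia.
    - pose proof (run_done _ _ _ R) as DE. simpl in DE. rewrite DE, app_nil_r, <- in_rev.
      intros Q2. apply B in Q2. lia.
    - replace (N - 1) with (0 + size h - 1) by lia. apply exit_ready; auto; [lia|].
      intros v Hv. apply A. lia.
    - apply (wf_stop _ _ W). }
  exists (E ++ [(p, N - 1)]). split; [|split; [|split; [|split]]].
  - eexists. split; [exact R'|]. intros v Hv. simpl in Hv |- *.
    destruct (Nat.eq_dec v (N - 1)); [left; auto|right; apply A; lia].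
  - apply (run_NoDup _ _ _ R').
  - intros v Hv. rewrite map_app, in_app_iff in Hv. destruct Hv as [Hv|[<-|[]]].
    + apply B in Hv. lia.
    + simpl. lia.
  - etransitivity; [exact V|apply devl_app_l].
  - unfold misses. rewrite <- (Nat.add_0_r (_ * _)).
    apply (misses_at_least_app G C E [(p, N - 1)] _ 0 M); [apply misses_at_least_0|].
    intros; simpl; lia.
Qed.

Lemma seq_execution h E : placed h 0 -> size h = N ->
  ws_execution G 1 E <-> E = map (pair 0) (seq 0 N).
Proof.
  intros H Hn. pose proof (size_ge h) as S2.
  assert (R : exists s, ws_run G 1 (ws_init G) (map (pair 0) (seq 0 N)) s /\
    cur s 0 = None /\ dq s 0 = [] /\ forall v, v < N -> In v (done s)).
  { destruct (seqrun_placed h 0 [] H ltac:(lia)) as [_ R]. simpl in R.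
    rewrite Nat.sub_0_r, Hn in R.
    exists (mkS (upd (fun _ => None) 0 None) (upd (fun _ => []) 0 []) (N - 1 :: rev (seq 0 (N - 1)))).
    repeat split; auto.
    - replace N with (N - 1 + 1) at 1 by lia. rewrite seq_snoc, map_app. eapply run_app.
      + replace (ws_init G) with (sst 0 []); [exact R|]. unfold sst, ws_init.
        rewrite (upd_same (fun _ => [])) by auto. reflexivity.
      + apply run_one.
        pose proof (exec_stop N L W 1 (upd (fun _ => None) 0 (Some (N - 1)))
          (upd (fun _ => []) 0 []) (rev (seq 0 (N - 1))) 0 (N - 1) ltac:(lia) (upd_eq _ _ _)
          ltac:(lia) (seq_fresh _) (seq_ready (N - 1) ltac:(lia)) (wf_stop _ _ W)) as Stp.
        now rewrite upd_upd in Stp.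
    - intros v Hv. destruct (Nat.eq_dec v (N - 1)) as [->|]; [now left|right].
      apply -> in_rev. apply in_seq. lia. }
  destruct R as (s & R & C0 & D0 & A). split.
  - intros (s1 & R1 & A1). eapply (sequential_unique N L W); eauto.
    intros v Hv. rewrite map_map, map_id in Hv. apply in_seq in Hv. lia.
  - intros ->. exists s. auto.
Qed.

Lemma seq_misses z h : k = 2 * (C + 1) * z -> 1 <= C -> placed h 0 -> size h = N ->
  misses G C (map (pair 0) (seq 0 N)) <= S C + 2 * (2 ^ h * (m * z)).
Proof.
  intros Hz HC H Hn. unfold misses. rewrite misses_aux_single.
  change (blk G) with (mem L). rewrite <- Hn.
  rewrite (accesses_placed h 0 z) by (auto; lia). apply sweeps_le; auto.
  apply sweep_rev, sweep_seq.
Qed.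
End Grid.

(** * Choice of parameters and final estimates *)

Lemma placed_tree m k C h : placed m k C (tree m k C h) h 0.
Proof. repeat split. Qed.

Lemma wf_tree m k C h : 1 <= m -> 1 <= k -> wf (size m k h) (tree m k C h).
Proof.
  intros Hm Hk. pose proof (size_ge m k Hm Hk h) as S2.
  destruct (placed_wf m k C _ Hm Hk h 0 (placed_tree m k C h)) as [A B]. split.
  - exact S2.
  - intros u Hu. apply A. simpl. lia.
  - destruct h as [|h]; simpl.
    + replace (gsize m k - 1) with (pos m k (gY (m - 1))) by (unfold gsize; simpl; lia).
      rewrite dec_pos by (simpl; lia). simpl. destruct (Nat.ltb_spec (m - 1 + 1) m); [lia|auto].
    + pose proof (size_ge m k Hm Hk h).
      repeat match goal with
      | |- context [?a =? ?b] => destruct (Nat.eqb_spec a b); try lia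
      | |- context [?a <? ?b] => destruct (Nat.ltb_spec a b); try lia
      end. auto.
  - intros v Hv. apply B. simpl. lia.
  - destruct h as [|h]; simpl; auto. unfold dec. destruct (Nat.ltb_spec 0 m); [auto|lia].
Qed.

(** [(C + 1) * z] is the first multiple of [C + 1] above [T], so a row has [z] whole sweeps in each
    direction; giving up one of them leaves at least [T - C] accesses. *)
Lemma grid_dimensions T C : 1 <= C -> C <= T ->
  let z := T / (C + 1) + 1 in
  T + 1 <= (C + 1) * z <= T + C + 1 /\ T <= (z - 1) * S C + C.
Proof.
  intros HC HT z. pose proof (Nat.div_mod T (C + 1) ltac:(lia)) as D.
  pose proof (Nat.mod_upper_bound T (C + 1) ltac:(lia)). unfold z. clear z.
  set (a := T / (C + 1)) in *. replace (a + 1 - 1) with a by lia. nia.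
Qed.

(** All quantities are compared with [A * T * T], where [A] is the number of grids. [P * s * s] is
    at most [4 * 12 * 12 = 576] times it, and the additional misses are at least a quarter of it,
    whence [2304 = 4 * 576]. *)
Lemma final_bounds A P C T s z k dev par sq :
  1 <= A -> 1 <= C -> 32 * C <= T -> 2 * A <= P <= 4 * A -> T <= s <= 12 * T ->
  k = 2 * (C + 1) * z -> T + 1 <= (C + 1) * z <= T + C + 1 -> T <= (z - 1) * S C + C ->
  A * (T * (k - 1)) <= dev -> A * (2 * T * ((z - 1) * S C)) <= par ->
  sq <= S C + 2 * (A * (T * z)) ->
  P * s * s <= 2304 * dev /\ P * s * s <= 2304 * (par - sq) /\ C * sq <= 2304 * (P * s * s).
Proof.
  intros HA HC HT HP Hs Hk Hz HM Hdev Hpar Hsq.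
  set (Q := A * (T * T)).
  assert (U : P * s * s <= 576 * Q).
  { transitivity (4 * A * (12 * T) * (12 * T)); [repeat apply Nat.mul_le_mono; lia|].
    unfold Q. lia. }
  assert (Lo : 2 * Q <= P * s * s).
  { transitivity (2 * A * T * T); [unfold Q; lia|repeat apply Nat.mul_le_mono; lia]. }
  assert (TT : T <= Q).
  { unfold Q. transitivity (1 * (1 * T)); [lia|]. repeat apply Nat.mul_le_mono; lia. }
  assert (CQ : S C * C <= Q).
  { unfold Q. transitivity (1 * (T * T)); [|apply Nat.mul_le_mono; lia].
    rewrite Nat.mul_1_l. apply Nat.mul_le_mono; lia. }
  split; [|split].
  - assert (Q <= dev); [|lia]. etransitivity; [|exact Hdev]. unfold Q.
    repeat apply Nat.mul_le_mono; lia.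
  - assert (Q <= 4 * (par - sq)); [|lia].
    assert (Hz2 : 2 * z <= T + C + 1) by nia.
    set (M := (z - 1) * S C) in *.
    assert (B1 : 2 * (A * (T * (T - C))) <= par).
    { etransitivity; [|exact Hpar].
      transitivity (A * (2 * T * (T - C))); [lia|]. repeat apply Nat.mul_le_mono; lia. }
    assert (B2 : sq <= S C + A * (T * (T + C + 1))).
    { etransitivity; [exact Hsq|]. apply Nat.add_le_mono_l.
      transitivity (A * (T * (2 * z))); [lia|]. repeat apply Nat.mul_le_mono; lia. }
    assert (B3 : A * (T * (T + C + 1)) + A * (T * (T - 3 * C - 1)) = 2 * (A * (T * (T - C)))).
    { rewrite <- Nat.mul_add_distr_l, <- Nat.mul_add_distr_l.
      replace (T + C + 1 + (T - 3 * C - 1)) with (2 * (T - C)) by lia. lia. }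
    (* [8 * (T - 3 * C - 1) >= 7 * T] amounts to [T >= 24 * C + 8], which follows from [32 * C <= T]
       and [1 <= C]. *)
    assert (B4 : 7 * Q <= 8 * (A * (T * (T - 3 * C - 1)))).
    { unfold Q. transitivity (A * (T * (7 * T))); [lia|].
      transitivity (A * (T * (8 * (T - 3 * C - 1)))); [|lia].
      do 2 apply Nat.mul_le_mono_l. lia. }
    lia.
  (* The initial sweep contributes at most [Q], the rounds at most [4 * Q], because
     [(C + 1) * z <= T + C + 1 <= 2 * T]. *)
  - assert (C * sq <= 5 * Q); [|lia].
    transitivity (C * (S C + 2 * (A * (T * z)))); [apply Nat.mul_le_mono_l; exact Hsq|].
    assert (B : A * (T * (2 * (C * z))) <= A * (T * (4 * T))).
    { do 2 apply Nat.mul_le_mono_l. nia. }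
    unfold Q in *. lia.
Qed.

Theorem mainTheorem4 :
  exists K c : nat, 1 <= K /\ 1 <= c /\
  forall P C T : nat, 2 <= P -> 1 <= C -> K * (Nat.log2 P + C) <= T ->
  exists (G : comp) (s : nat) (E : list (nat * nat)),
    structured_single_touch G /\ has_span G s /\ T <= s <= K * T /\
    ws_execution G P E /\
    (exists S, sequential_execution G S) /\
    forall S, sequential_execution G S ->
      P * s * s <= c * deviations S E /\
      P * s * s <= c * (misses G C E - misses G C (map (pair 0) S)) /\
      C * misses G C (map (pair 0) S) <= c * (P * s * s).
Proof.
  (* Both constants serve [final_bounds]; 32 also absorbs the terms in [C] and in the height of the
     tree, so that the span is at most [12 * T]. *)
  exists 32, 2304. split; [lia|]. split; [lia|]. intros P C T HP HC HT.
  assert (HP1 : 1 <= Nat.log2 P) by (apply Nat.log2_le_pow2; simpl; lia).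
  destruct (Nat.log2_spec P ltac:(lia)) as [HP2 HP3].
  pose proof (Nat.log2_lt_lin P ltac:(lia)) as HP4.
  (* The height of the tree is [log2 P - 1]. Its [2 ^ h] grids satisfy [2 * 2 ^ h <= P < 4 * 2 ^ h],
     and [h + 2 <= P] processors suffice. *)
  destruct (Nat.log2 P) as [|h]; [lia|].
  rewrite Nat.pow_succ_r' in HP2. do 2 rewrite Nat.pow_succ_r' in HP3.
  set (z := T / (C + 1) + 1). set (k := 2 * (C + 1) * z).
  destruct (grid_dimensions T C HC ltac:(lia)) as [Z1 Z2]. fold z in Z1, Z2.
  assert (Hm : 1 <= T) by lia. assert (Hk : 1 <= k) by lia.
  pose proof (wf_tree T k C h Hm Hk) as W.
  pose proof (placed_tree T k C h) as Pl.
  set (N := size T k h) in *. set (L := tree T k C h) in *.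
  pose proof (size_ge T k Hm Hk h) as S2. fold N in S2.
  set (G := comp_of N L).
  destruct (placed_depth T k C L Hm Hk N h 0 Pl (le_n N)) as (dep & D1 & D2).
  destruct (placed_path T k C L Hm Hk N h 0 Pl (le_n N)) as (l0 & Pl0 & Ll0).
  (* A path along one row has [k > 2 * T] nodes, which gives the lower bound on the span; the depth
     function gives the upper one. *)
  destruct (span_exists G (S (2 * T + 2 * k + 2 + 2 * h)) l0 Pl0) as (s & Hs & Hs2).
  { apply (path_length_le G dep). intros u v Huv. pose proof (step_lt N L W u v Huv).
    split; [apply D1; auto; lia|apply D2; lia]. }
  destruct (par_execution T k C L Hm Hk N W P z h eq_refl HC Pl eq_refl ltac:(lia))
    as (E & E1 & E2 & E3 & E4 & E5).
  exists G, s, E. split; [|split; [|split; [|split; [|split]]]]; auto.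
  - apply comp_of_single_touch; auto.
    + apply (placed_main T k C L Hm Hk N h 0 Pl (le_n N)).
    + intros u r Hu Eu.
      apply (placed_forks T k C L Hm Hk N h 0 u r Pl (le_n N)); auto.
      pose proof (wf_stop N L W). destruct (Nat.eq_dec u (N - 1)) as [->|]; [congruence|].
      fold N. lia.
  - lia.
  - exists (seq 0 N), (map (pair 0) (seq 0 N)). split; [|now rewrite map_map, map_id].
    now apply (seq_execution T k C L Hm Hk N W h).
  - intros Sq (E0 & H0 & ->).
    apply (seq_execution T k C L Hm Hk N W h) in H0; auto. subst E0.
    rewrite map_map, map_id.
    pose proof (seq_misses T k C L Hm Hk N z h eq_refl HC Pl eq_refl) as Q.
    pose proof (deviations_ge N E E2 E3) as V.
    eapply (final_bounds (2 ^ h) P C T s z k); eauto; try lia.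
    all: pose proof (Nat.pow_nonzero 2 h ltac:(lia)); lia.
Qed.
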